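(* Let $A$ be a separable unital C*-algebra and let $\pi : A \to B(H)$ be a unital representation on a separable Hilbert space $H$. Suppose $\mathcal{L} \subset \pi(A)'$ is a decomposable maximal abelian von Neumann subalgebra of $\pi(A)'$, and let $\mathcal{P}_{\mathcal{L}} \subset \mathcal{L}$ be the associated distinguished family of projections. Then there exists a decomposable weak expectation of $\pi$ with respect to $\mathcal{L}$ if and only if $\mathcal{P}_{\mathcal{L}} \subset \pi(A)''$.
   Context: Commutants are taken in $B(H)$. Direct integral decomposition. Let $\mathcal{L}$ be a maximal abelian von Neumann subalgebra of $\pi(A)'$. There are a standard measure space $(X,\mu)$ with $\mu$ positive and bounded, a measurable family of Hilbert spaces $\{H_p\}_{p\in X}$, a measurable family of representations $\pi_p : A \to B(H_p)$, and a unitary $H \to \int_X^{\oplus} H_p\, d\mu(p)$ carrying $\mathcal{L}$ onto the algebra $L^\infty(X,\mu)$ of diagonalizable operators and $\pi$ onto $\int_X^\oplus \pi_p\, d\mu(p)$. This is the decomposition of $\pi$ with respect to $\mathcal{L}$; identify $H$ with the direct integral. Since $\mathcal{L}$ is maximal abelian in $\pi(A)'$, $\pi_p$ is irreducible for $\mu$-almost every $p$. Decomposable $\mathcal{L}$. Let $X_0$ be a $\mu$-null set such that $\pi_p$ is irreducible for all $p \in X\setminus X_0$. For $p\in X\setminus X_0$ put $E_p = \{q \in X\setminus X_0 : \pi_q \text{ is unitarily equivalent to } \pi_p\}$. The sets $E_p$ partition $X\setminus X_0$. The maximal abelian algebra $\mathcal{L}$ is called decomposable if, for some such null set $X_0$,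 this partition consists of countably many distinct classes, each of which is measurable. (This does not depend on the choice of $(X,\mu)$.) The family $\mathcal{P}_{\mathcal{L}}$. If $\mathcal{L}$ is decomposable, $\mathcal{P}_{\mathcal{L}}=\{P_\lambda\}_{\lambda\in\Lambda}$ is the countable family of mutually orthogonal nonzero projections $P_\lambda = \chi_{E_\lambda} \in L^\infty(X,\mu) = \mathcal{L}$, where, for a null set $X_0$ such that the partition of $X\setminus X_0$ into the sets $E_p = \{q \in X\setminus X_0 : \pi_q \text{ is unitarily equivalent to } \pi_p\}$ consists of countably many measurable classes, $E_\lambda$ runs over the distinct equivalence classes $E_p$ of this partition having $\mu(E_\lambda)\neq 0$. Decomposable weak expectation. Let $\mathcal{R}$ be the von Neumann algebra of decomposable operators on $H=\int_X^\oplus H_p\,d\mu(p)$; equivalently $\mathcal{R}=\mathcal{L}'$. Note $\pi(A)''\subset \mathcal{R}$. A weak expectation of $\pi$ on $\mathcal{R}$ is a unital completely positive map $\Phi : \mathcal{R} \to \pi(A)''$ with $\Phi(\pi(a)) = \pi(a)$ for all $a\in A$. It is called decomposable (with respect to $\mathcal{L}$) if $\Phi(P_\lambda T) = P_\lambda \Phi(T)$ for all $P_\lambda \in \mathcal{P}_{\mathcal{L}}$ and all $T \in \mathcal{R}$. *)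

(* Defs.v *)
From HB Require Import structures.
From mathcomp Require Import all_boot all_order all_algebra.
From mathcomp Require Import complex.
From mathcomp Require Import all_classical all_reals all_analysis.

Set Implicit Arguments.
Unset Strict Implicit.
Unset Printing Implicit Defensive.

Import Order.TTheory GRing.Theory Num.Theory.
Import numFieldNormedType.Exports.

Local Open Scope classical_set_scope.
Local Open Scope complex_scope.
Local Open Scope ring_scope.

(* Scalars are the complex numbers R[i] over an arbitrary R : realType.  Norms
   therefore take their values in R[i] (as nonnegative reals), and [0 <= z]
   for z : R[i] means that z is real and nonnegative.                         *)

HB.mixin Record isHilbert (R : realType) V & CompleteNormedModule R[i] V := {
  inner : V -> V -> R[i];
  innerDZl : forall (c : R[i]) (x y z : V),
    inner (c *: x + y) z = c * inner x z + inner y z;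
  inner_conj : forall x y : V, inner y x = (inner x y)^*;
  inner_normE : forall x : V, inner x x = `|x| ^+ 2
}.

#[short(type="hilbertType")]
HB.structure Definition Hilbert (R : realType) :=
  {V of CompleteNormedModule R[i] V & isHilbert R V}.

(* A unital C*-algebra.  The product is a field of the mixin because Num.NumDomain
   prevents Hierarchy Builder from joining a ring structure with an independent
   normed module structure.                                                   *)
HB.mixin Record isCStarAlgebra (R : realType) A & CompleteNormedModule R[i] A := {
  amul : A -> A -> A;
  aone : A;
  star : A -> A;
  amulA : associative amul;
  amul1l : left_id aone amul;
  amul1r : right_id aone amul;
  amulDZl : forall (c : R[i]) (a b x : A),
    amul (c *: a + b) x = c *: amul a x + amul b x;
  amulDZr : forall (c : R[i]) (x a b : A),
    amul x (c *: a + b) = c *: amul x a + amul x b;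
  starDZ : forall (c : R[i]) (a b : A), star (c *: a + b) = c^* *: star a + star b;
  starM : forall a b : A, star (amul a b) = amul (star b) (star a);
  starK : involutive star;
  amul_norm : forall a b : A, `|amul a b| <= `|a| * `|b|;
  cstar_norm : forall a : A, `|amul (star a) a| = `|a| ^+ 2
}.

#[short(type="cstarAlgType")]
HB.structure Definition CStarAlgebra (R : realType) :=
  {A of CompleteNormedModule R[i] A & isCStarAlgebra R A}.

Definition separable (T : topologicalType) :=
  exists D : set T, countable D /\ dense D.

Definition hnorm (R : realType) (V : hilbertType R) (x : V) : R :=
  complex.Re `|x|.

Section Operators.
Context (R : realType).

Definition bounded_op (H K : hilbertType R) (T : H -> K) :=
  linear T /\ continuous T.

Definition adjoint (H : hilbertType R) (T S : H -> H) :=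
  forall x y, inner (T x) y = inner x (S y).

Definition commutant (H : hilbertType R) (M : set (H -> H)) : set (H -> H) :=
  [set T | bounded_op T /\ forall S, M S -> T \o S = S \o T].

Definition von_neumann_algebra (H : hilbertType R) (M : set (H -> H)) :=
  [/\ forall T, M T -> bounded_op T,
      forall T S, M T -> bounded_op S -> adjoint T S -> M S
    & commutant (commutant M) = M].

Definition abelian (H : hilbertType R) (M : set (H -> H)) :=
  forall S T, M S -> M T -> S \o T = T \o S.

Definition maximal_abelian (H : hilbertType R) (L N : set (H -> H)) :=
  [/\ von_neumann_algebra L, abelian L, L `<=` N
    & forall M, von_neumann_algebra M -> abelian M -> M `<=` N ->
        L `<=` M -> M = L].

Definition linear_on (H : hilbertType R) (M : set (H -> H))
    (Phi : (H -> H) -> (H -> H)) :=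
  forall (c : R[i]) S T, M S -> M T ->
    Phi ((c \*: S) \+ T) = (c \*: Phi S) \+ Phi T.

(* An operator matrix in M_n(B(H)) acts on H^n. *)
Definition positive_opmx (H : hilbertType R) n (T : 'I_n -> 'I_n -> H -> H) :=
  forall x : 'I_n -> H,
    0 <= \sum_(i < n) \sum_(j < n) inner (T i j (x j)) (x i).

Definition completely_positive_on (H : hilbertType R) (M : set (H -> H))
    (Phi : (H -> H) -> (H -> H)) :=
  linear_on M Phi /\
  forall n (T : 'I_n -> 'I_n -> H -> H), (forall i j, M (T i j)) ->
    positive_opmx T -> positive_opmx (fun i j => Phi (T i j)).

End Operators.

Section Representations.
Context (R : realType) (A : cstarAlgType R).

Definition representation (H : hilbertType R) (pi : A -> H -> H) :=
  [/\ forall a, bounded_op (pi a),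
      forall (c : R[i]) a b, pi (c *: a + b) = (c \*: pi a) \+ pi b,
      forall a b, pi (amul a b) = pi a \o pi b
    & forall a, adjoint (pi a) (pi (star a))].

Definition unital_representation (H : hilbertType R) (pi : A -> H -> H) :=
  representation pi /\ pi aone = id.

Definition closed_subspace (H : hilbertType R) (V : set H) :=
  [/\ V 0, forall (c : R[i]) x y, V x -> V y -> V (c *: x + y) & closed V].

(* The first clause excludes the zero representation. *)
Definition irreducible (H : hilbertType R) (pi : A -> H -> H) :=
  (exists a x, pi a x <> 0) /\
  forall V, closed_subspace V -> (forall a x, V x -> V (pi a x)) ->
    V = [set 0] \/ V = setT.

Definition unitarily_equivalent (H K : hilbertType R)
    (pi : A -> H -> H) (rho : A -> K -> K) :=
  exists U : H -> K,
    [/\ linear U, forall x y, inner (U x) (U y) = inner x y,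
        forall y, exists x, U x = y
      & forall a, U \o pi a = rho a \o U].

End Representations.

(* X is Borel isomorphic to a Polish space Y. *)
Definition standard_borel (R : realType) d (X : measurableType d) :=
  exists (Y : completePseudoMetricType R) (f : X -> Y),
    [/\ hausdorff_space Y, separable Y, bijective f
      & @measurable d X = [set f @^-1` B | B in <<s @open Y >>]].

Definition cmeasurable (R : realType) d (X : measurableType d) (f : X -> R[i]) :=
  measurable_fun setT (fun p => complex.Re (f p)) /\
  measurable_fun setT (fun p => complex.Im (f p)).

(* A measurable family of Hilbert spaces, given with its measurable sections. *)
Record hilbert_field (R : realType) d (X : measurableType d) := HilbertField {
  fiber :> X -> hilbertType R;
  msection : set (forall p, fiber p);
  msection0 : msection (fun=> 0);
  msectionDZ : forall (c : R[i]) s t, msection s -> msection t ->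
    msection (fun p => c *: s p + t p);
  msection_norm : forall s, msection s -> measurable_fun setT (fun p => hnorm (s p));
  msection_complete : forall t,
    (forall s, msection s -> cmeasurable (fun p => inner (t p) (s p))) ->
    msection t;
  msection_total : exists e : nat -> forall p, fiber p,
    (forall n, msection (e n)) /\
    forall p, dense [set v | exists n (c : nat -> R[i]),
                               v = \sum_(k < n) c k *: e k p]
}.

Section DirectIntegrals.
Context (R : realType) (d : measure_display) (X : measurableType d).
Context (mu : {finite_measure set X -> \bar R}) (K : hilbert_field R X).
Context (H : hilbertType R) (W : H -> forall p, K p).

(* W x is a representative of the image of x, so that W is unitary from H onto
   the direct integral, whose vectors are the square-integrable measurable
   sections up to equality mu-almost everywhere.                             *)
Definition unitary_onto_direct_integral :=
  [/\ forall x, msection (W x),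
      forall (c : R[i]) x y,
        {ae mu, forall p, W (c *: x + y) p = c *: W x p + W y p},
      forall x, (\int[mu]_p (hnorm (W x p) ^+ 2)%:E)%E = (hnorm x ^+ 2)%:E
    & forall s, msection s ->
        (\int[mu]_p (hnorm (s p) ^+ 2)%:E < +oo)%E ->
        exists x, {ae mu, forall p, W x p = s p}].

Definition Linfty (f : X -> R[i]) :=
  cmeasurable f /\
  exists M : R, {ae mu, forall p, complex.Re `|f p| <= M}.

Definition diagonal_op (f : X -> R[i]) (T : H -> H) :=
  bounded_op T /\ forall x, {ae mu, forall p, W (T x) p = f p *: W x p}.

Definition diagonal_algebra : set (H -> H) :=
  [set T | exists2 f, Linfty f & diagonal_op f T].

Definition decomposable_ops : set (H -> H) :=
  [set T | bounded_op T /\ exists T_ : forall p, K p -> K p,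
    [/\ forall p, bounded_op (T_ p),
        forall s, msection s -> msection (fun p => T_ p (s p)),
        exists M : R, {ae mu, forall p, forall v, hnorm (T_ p v) <= M * hnorm v}
      & forall x, {ae mu, forall p, W (T x) p = T_ p (W x p)}]].

Context (A : cstarAlgType R) (pi : A -> H -> H).
Unset Implicit Arguments.
Context (pi_ : forall p, A -> K p -> K p).
Set Implicit Arguments.

Definition measurable_representations :=
  (forall p, representation (pi_ p)) /\
  forall a s, msection s -> msection (fun p => pi_ p a (s p)).

(* The decomposition of pi with respect to L. *)
Definition direct_integral_decomposition (L : set (H -> H)) :=
  [/\ standard_borel R X, unitary_onto_direct_integral,
      measurable_representations,
      L = diagonal_algebra
    & forall a x, {ae mu, forall p, W (pi a x) p = pi_ p a (W x p)}].

Definition fiber_equiv_class (X0 : set X) (p : X) : set X :=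
  [set q | ~ X0 q /\ unitarily_equivalent (pi_ q) (pi_ p)].

Definition decomposing_null_set (X0 : set X) :=
  [/\ mu.-negligible X0,
      forall p, ~ X0 p -> irreducible (pi_ p),
      countable [set fiber_equiv_class X0 p | p in ~` X0]
    & forall p, ~ X0 p -> measurable (fiber_equiv_class X0 p)].

(* Decomposability of the algebra L = diagonal_algebra. *)
Definition decomposable_masa := exists X0, decomposing_null_set X0.

(* The family P_L.  A different choice of X0 changes each class by a null set
   only, hence gives the same operators.                                     *)
Definition class_projections : set (H -> H) :=
  [set P | exists X0 p, [/\ decomposing_null_set X0, ~ X0 p,
    mu (fiber_equiv_class X0 p) != 0%E
    & diagonal_op (fun q => \1_(fiber_equiv_class X0 p) q) P]].

Definition weak_expectation (Phi : (H -> H) -> (H -> H)) :=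
  [/\ forall T, decomposable_ops T -> commutant (commutant (range pi)) (Phi T),
      completely_positive_on decomposable_ops Phi,
      Phi id = id
    & forall a, Phi (pi a) = pi a].

Definition decomposable_weak_expectation (Phi : (H -> H) -> (H -> H)) :=
  weak_expectation Phi /\
  forall P T, class_projections P -> decomposable_ops T ->
    Phi (P \o T) = P \o Phi T.

End DirectIntegrals.

(* Main.v *)
Require Import Defs.
From HB Require Import structures.
From mathcomp Require Import all_boot all_order all_algebra.
From mathcomp Require Import complex.
From mathcomp Require Import all_classical all_reals all_analysis.
From mathcomp Require Import measurable_realfun ring lra.

(** If [Phi] is a decomposable weak expectation, then [P = P Phi(1) = Phi(P)] lies
    in [pi(A)''].

    Conversely, let [E] be a class of positive measure, [p0] a point of [E] and
    [U_q : K q -> K p0] unitaries implementing the equivalences.  The operators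
    [T] on [K p0] for which the field [q |-> U_q^* T U_q] on [E] is measurable
    and implemented by an element of [pi(A)''] form a *-algebra closed under
    bounded sequential strong limits; it contains [pi_p0(A)] because the
    projection of [E] is in [pi(A)''].  No measurable choice of the [U_q] is
    needed: such an algebra, if irreducible, contains every bounded operator.
    For that, approximate a selfadjoint [S] by selfadjoint [T_n] of the algebra
    on a total sequence (double commutant argument); the resolvents
    [(T_n - i)^-1] converge strongly to [(S - i)^-1], from which [S] is recovered
    by Neumann series.

    In particular rank one operators on [K p0] act on [H] through [E], which
    yields an isometric intertwiner [V : K p0 -> H] onto a subspace of the range
    of the projection of [E].  The weak expectation sends [T] to the operator
    whose fiber at [q] in [E] is [U_q^* V^* T V U_q]. *)

Set Implicit Arguments.
Unset Strict Implicit.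
Unset Printing Implicit Defensive.

Import Order.TTheory GRing.Theory Num.Theory.
Import numFieldNormedType.Exports.

Local Open Scope classical_set_scope.
Local Open Scope complex_scope.
Local Open Scope ring_scope.

(** * The real inner product *)

(** Closure under bounded sequential strong limits is the closure that passes between operators on
    [H] and fields of fiber operators, because dominated convergence handles sequences only and
    needs a uniform bound. The double commutant argument yields approximants without norm control;
    this is why their resolvents, always contractions, take their place. Inverses and square roots
    come from iterations dominated by a scalar recursion, so no spectral theorem enters.

    The expectation compresses [T] by [V] and never looks at the fibers of [T], hence it makes sense
    for every bounded [T]. On each fiber it is a compression by an isometry, which gives complete
    positivity. The nontrivial point is that its values lie in pi(A)'': that is the statement on
    transported fields, applied to the compression of [T]. The countably many classes are then
    glued; at most one class contributes at each fiber, so partial sums keep the norm bound of [T].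
    A class projection is compatible with the map because it acts on the range of each [V] as the
    identity or as zero. *)

Section RealInner.
Context (R : realType) (V : hilbertType R).
Implicit Types (x y z : V) (c : R[i]).

(** The order of [R[i]] is only partial, so estimates are carried out on the real part. Nothing is
    lost: [inner_ripE] recovers the imaginary part from ['i *: x]. *)
Definition rip x y : R := complex.Re (inner x y).

Lemma innerD x y z : inner (x + y) z = inner x z + inner y z.
Proof. by rewrite -{1}(scale1r x) innerDZl mul1r. Qed.

Lemma inner0l z : inner 0 z = 0.
Proof. by apply: (addrI (inner 0 z)); rewrite -innerD !addr0. Qed.

Lemma innerZ c x y : inner (c *: x) y = c * inner x y.
Proof. by rewrite -{1}(addr0 (c *: x)) innerDZl inner0l addr0. Qed.

Lemma innerZr c x y : inner x (c *: y) = c^* * inner x y.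
Proof. by rewrite !(inner_conj _ x) innerZ rmorphM. Qed.

Lemma Re_conj c : complex.Re c^* = complex.Re c.
Proof. by case: c. Qed.

Lemma Re_norm_ge0 c : 0 <= complex.Re `|c|.
Proof. by rewrite normc_def sqrtr_ge0. Qed.

Lemma ripC x y : rip x y = rip y x.
Proof. by rewrite /rip inner_conj Re_conj. Qed.

Lemma ripDl x y z : rip (x + y) z = rip x z + rip y z.
Proof. by rewrite /rip innerD raddfD. Qed.

Lemma ripDr x y z : rip x (y + z) = rip x y + rip x z.
Proof. by rewrite !(ripC x) ripDl. Qed.

Lemma ripZl (r : R) x y : rip (r%:C *: x) y = r * rip x y.
Proof. by rewrite /rip innerZ; case: (inner x y) => a b /=; rewrite mul0r subr0. Qed.

Lemma ripZr (r : R) x y : rip x (r%:C *: y) = r * rip x y.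
Proof. by rewrite ripC ripZl ripC. Qed.

Lemma rip_conj c x y : rip (c *: x) y = rip x (c^* *: y).
Proof. by rewrite /rip innerZ innerZr conjCK. Qed.

Lemma rip_conjr c x y : rip x (c *: y) = rip (c^* *: x) y.
Proof. by rewrite ripC rip_conj ripC. Qed.

Lemma inner_ripE x y : inner x y = (rip x y) +i* (- rip ('i *: x) y).
Proof.
rewrite /rip innerZ; case: (inner x y) => a b /=.
by rewrite mul0r mul1r sub0r opprK.
Qed.

Lemma normE x : `|x| = (hnorm x)%:C.
Proof.
rewrite /hnorm RRe_real //; exact: ger0_real.
Qed.

Lemma ripE x : rip x x = hnorm x ^+ 2.
Proof. by rewrite /rip inner_normE normE -rmorphXn. Qed.

Lemma hnorm_ge0 x : 0 <= hnorm x.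
Proof. by rewrite -ler0c -normE. Qed.

Lemma hnorm0 : hnorm (0 : V) = 0.
Proof. by rewrite /hnorm normr0. Qed.

Lemma hnorm_eq0 x : hnorm x = 0 -> x = 0.
Proof. by move=> h; apply/eqP; rewrite -normr_eq0 normE h. Qed.

Lemma hnorm_opp x : hnorm (- x) = hnorm x.
Proof. by rewrite /hnorm normrN. Qed.

Lemma hnormC x y : hnorm (x - y) = hnorm (y - x).
Proof. by rewrite -hnorm_opp opprB. Qed.

Lemma ler_hnormD x y : hnorm (x + y) <= hnorm x + hnorm y.
Proof. by rewrite -lecR rmorphD /= -!normE ler_normD. Qed.

Lemma hnormZ c x : hnorm (c *: x) = complex.Re `|c| * hnorm x.
Proof.
apply: complexI; rewrite rmorphM -!normE normrZ; congr (_ * _).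
by apply/esym/RRe_real/ger0_real.
Qed.

Lemma hnormZr (r : R) x : hnorm (r%:C *: x) = `|r| * hnorm x.
Proof. by rewrite hnormZ normc_def /= expr0n addr0 sqrtr_sqr. Qed.

Lemma hnormZi x : hnorm ('i *: x) = hnorm x.
Proof. by rewrite hnormZ normc_def /= expr0n expr1n add0r sqrtr1 mul1r. Qed.

Lemma scale_conji x : ('i : R[i])^* *: x = - ('i *: x).
Proof.
by rewrite -scaleNr; congr (_ *: _); apply/eqP; rewrite eq_complex /= oppr0 !eqxx.
Qed.

Lemma rip_eq0 x : rip x x = 0 -> x = 0.
Proof. by move/eqP; rewrite ripE sqrf_eq0 => /eqP/hnorm_eq0. Qed.

Lemma ripNl x y : rip (- x) y = - rip x y.
Proof. by rewrite /rip -scaleN1r innerZ mulN1r raddfN. Qed.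

Lemma ripNr x y : rip x (- y) = - rip x y.
Proof. by rewrite ripC ripNl ripC. Qed.

Lemma ripBl x y z : rip (x - y) z = rip x z - rip y z.
Proof. by rewrite ripDl ripNl. Qed.

Lemma ripBr x y z : rip z (x - y) = rip z x - rip z y.
Proof. by rewrite ripDr ripNr. Qed.

Lemma rip_inj x y : (forall z, rip x z = rip y z) -> x = y.
Proof.
move=> h; apply/eqP; rewrite -subr_eq0; apply/eqP/rip_eq0.
by rewrite ripBl h subrr.
Qed.

Lemma rip0l x : rip 0 x = 0.
Proof. by rewrite /rip inner0l. Qed.

Lemma rip0r x : rip x 0 = 0.
Proof. by rewrite ripC rip0l. Qed.

Lemma rip_suml (I : Type) (s : seq I) (f : I -> V) x :
  rip (\sum_(i <- s) f i) x = \sum_(i <- s) rip (f i) x.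
Proof.
elim: s => [|i s IH]; first by rewrite !big_nil rip0l.
by rewrite !big_cons ripDl IH.
Qed.

End RealInner.

(** * Positive real forms: Cauchy-Schwarz and best approximation *)

Section PositiveForms.
Context (R : realType) (V : lmodType R[i]) (f : V -> V -> R).
Hypothesis fC : forall x y, f x y = f y x.
Hypothesis fD : forall x y z, f (x + y) z = f x z + f y z.
Hypothesis fZ : forall (r : R) x y, f (r%:C *: x) y = r * f x y.
Hypothesis f_ge0 : forall x, 0 <= f x x.

Lemma form_expand x y (r : R) :
  f (x + r%:C *: y) (x + r%:C *: y) = f x x + 2 * r * f x y + r ^+ 2 * f y y.
Proof.
rewrite !fD !fZ !(fC _ (_ + _)) !fD !fZ (fC y x); ring.
Qed.

(** Definiteness is not assumed: besides [rip] and [amp_rip], the inequality is applied to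
    [rip (A x) y] for a merely positive [A]. *)
Lemma form_CS x y : f x y ^+ 2 <= f x x * f y y.
Proof.
have := f_ge0 y; rewrite le_eqVlt => /orP[/eqP y0|y0].
  have [->|n0] := eqVneq (f x y) 0; first by rewrite -y0 expr0n mulr0.
  (* When [f y y = 0] the expansion is affine in the scalar, which is chosen to give the value
     -1. *)
  have := f_ge0 (x + (- (f x x + 1) / (2 * f x y))%:C *: y).
  rewrite form_expand -y0 !mulr0 addr0 !mulrA.
  have -> : f x x + 2 * (- (f x x + 1)) / (2 * f x y) * f x y = - 1.
    by field.
  by move=> ?; lra.
have := f_ge0 (x + (- f x y / f y y)%:C *: y).
rewrite form_expand.
have -> : f x x + 2 * (- f x y / f y y) * f x y + (- f x y / f y y) ^+ 2 * f y y
   = f x x - f x y ^+ 2 / f y y by field; exact: lt0r_neq0.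
by rewrite subr_ge0 ler_pdivrMr.
Qed.

Lemma form_parallelogram x y :
  f (x + y) (x + y) + f (x - y) (x - y) = 2 * f x x + 2 * f y y.
Proof.
have e1 := form_expand x y 1; have e2 := form_expand x y (-1).
rewrite scale1r in e1; rewrite rmorphN1 scaleN1r in e2.
rewrite e1 e2; ring.
Qed.

(* Best approximation from a real subspace: the limit [y0] of a minimizing
   sequence exists by the parallelogram law. *)
Lemma form_projection (Y : set V) (x : V) :
  (forall u : nat -> V,
     (forall e : R, 0 < e -> exists N, forall i j, (N <= i)%N -> (N <= j)%N ->
        f (u i - u j) (u i - u j) < e) ->
     exists l, forall e : R, 0 < e -> exists N, forall i, (N <= i)%N ->
        f (u i - l) (u i - l) < e) ->
  Y 0 -> (forall (r : R) a b, Y a -> Y b -> Y (a + r%:C *: b)) ->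
  exists y0, (forall e : R, 0 < e -> exists2 y, Y y & f (y - y0) (y - y0) < e) /\
    forall y, Y y -> f (x - y0) y = 0.
Proof.
move=> compl Y0 Ylin.
pose D := [set f (x - y) (x - y) | y in Y].
have D0 : D !=set0 by exists (f (x - 0) (x - 0)); exists 0.
have Dlb : has_lbound D by exists 0 => _ [y _ <-].
have hD : has_inf D by [].
set m := inf D.
have mle y : Y y -> m <= f (x - y) (x - y).
  by move=> Yy; apply: ge_inf => //; exists y.
have ap (n : nat) : exists y, Y y /\ f (x - y) (x - y) < m + n.+1%:R^-1.
  have := @lt_inf_imfset _ _.
  have : m < m + n.+1%:R^-1 by rewrite ltrDl invr_gt0.
  by move=> /(inf_lt D0)[_ [y Yy <-] h]; exists y.
have [u hu] := choice ap.
have small (i j : nat) : f (u i - u j) (u i - u j) <= 2 * (i.+1%:R^-1 + j.+1%:R^-1).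
  have mid : Y ((2^-1)%:C *: (u i + u j)).
    have := Ylin 2^-1 _ _ (Ylin 2^-1 0 (u i) Y0 (hu i).1) (hu j).1.
    by rewrite add0r -scalerDr.
  have := form_parallelogram (x - u i) (x - u j).
  have -> : x - u i - (x - u j) = - (u i - u j) by rewrite !opprB addrC addrA subrK.
  have fN v : f (- v) (- v) = f v v.
    have := fZ (-1) v (- v); rewrite rmorphN1 scaleN1r => ->.
    by rewrite fC; have := fZ (-1) v v; rewrite rmorphN1 scaleN1r => ->; ring.
  rewrite fN.
  have -> : x - u i + (x - u j) = 2%:C *: (x - (2^-1)%:C *: (u i + u j)).
    rewrite scalerBr scalerA -rmorphM /= divff // scale1r.
    by rewrite (_ : 2%:C = 2) ?rmorph_nat // scaler_nat mulr2n opprD addrACA.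
  rewrite fZ fC fZ.
  have := mle _ mid; have := (hu i).2; have := (hu j).2.
  move: (j.+1%:R^-1) (i.+1%:R^-1) => a b h1 h2 h3 h4; lra.
have [|y0 hy0] := compl u.
  move=> e e0.
  have [N hN] : exists N : nat, N.+1%:R^-1 < e / 4.
    have e4 : 0 < e / 4 by lra.
    have [N _ hN] := near_infty_natSinv_lt (PosNum e4).
    by exists N; apply: hN => /=.
  exists N => i j Ni Nj; apply: (le_lt_trans (small i j)).
  have hle (k : nat) : (N <= k)%N -> k.+1%:R^-1 <= N.+1%:R^-1 :> R.
    by move=> Nk; rewrite lef_pV2 ?posrE // ler_nat.
  have := hle _ Ni; have := hle _ Nj.
  by move: (i.+1%:R^-1) (j.+1%:R^-1) (N.+1%:R^-1) hN => a b c; lra.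
exists y0; split.
  by move=> e e0; have [N hN] := hy0 e e0; exists (u N); [exact: (hu N).1|exact: hN].
move=> y Yy.
have [yy0|yyn0] := eqVneq (f y y) 0.
  apply/eqP; rewrite -sqrf_eq0 eq_le sqr_ge0 andbT.
  by have := form_CS (x - y0) y; rewrite yy0 mulr0.
have yy_gt0 : 0 < f y y by rewrite lt_neqAle eq_sym yyn0 f_ge0.
(* Moving [u k] along [y] by the optimal scalar lowers the squared distance to [x] by
   [f (x - u k) y ^+ 2 / f y y]. The result is still at least [m], while [u k] was within
   [k.+1%:R^-1] of [m]. *)
have orth k : f (x - u k) y ^+ 2 <= k.+1%:R^-1 * f y y.
  set r := f (x - u k) y / f y y.
  have := mle _ (Ylin r _ _ (hu k).1 Yy).
  have -> : x - (u k + r%:C *: y) = x - u k + (- r)%:C *: y.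
    by rewrite opprD addrA rmorphN scaleNr.
  rewrite form_expand -addrA.
  have -> : 2 * - r * f (x - u k) y + (- r) ^+ 2 * f y y = - (f (x - u k) y ^+ 2 / f y y).
    by rewrite /r; field.
  move=> h1; have h2 := (hu k).2; rewrite -ler_pdivrMr //.
  move: (k.+1%:R^-1) h1 h2 => a h1 h2; lra.
apply/eqP; rewrite -sqrf_eq0 eq_le sqr_ge0 andbT.
apply/ler_addgt0Pr => e e0; rewrite add0r.
have d0 : 0 < e / (4 * f y y) by rewrite divr_gt0 // mulr_gt0.
have [N1 hN1] := hy0 _ d0.
have [N2 _ hN2] := near_infty_natSinv_lt (PosNum d0).
pose k := maxn N1 N2.
have k1 := hN1 k (leq_maxl _ _); have /= k2 := hN2 k (leq_maxr _ _).
have -> : f (x - y0) y = f (x - u k) y + f (u k - y0) y.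
  by rewrite -fD addrA subrK.
have h3 := orth k; have h4 := form_CS (u k - y0) y.
have h5 : k.+1%:R^-1 * f y y <= e / 4.
  have -> : e / 4 = e / (4 * f y y) * f y y by field.
  by rewrite ler_pM2r // ltW.
have h6 : f (u k - y0) (u k - y0) * f y y <= e / 4.
  have -> : e / 4 = e / (4 * f y y) * f y y by field.
  by rewrite ler_pM2r // ltW.
have := sqr_ge0 (f (x - u k) y - f (u k - y0) y).
move: (le_trans h3 h5) (le_trans h4 h6) => {h3 h4 h5 h6 k1 k2}.
move: (f (x - u k) y) (f (u k - y0) y) => a b h1 h2 h3.
have -> : (a + b) ^+ 2 = 2 * a ^+ 2 + 2 * b ^+ 2 - (a - b) ^+ 2 by ring.
lra.
Qed.

End PositiveForms.

Section LinearMaps.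
Context (K : pzRingType) (V W : lmodType K) (T : V -> W).
Hypothesis linT : linear T.

Lemma linearD_of x y : T (x + y) = T x + T y.
Proof. by have := linT 1 x y; rewrite !scale1r. Qed.

Lemma linear0_of : T 0 = 0.
Proof. by apply: (addrI (T 0)); rewrite -linearD_of !addr0. Qed.

Lemma linearZ_of c x : T (c *: x) = c *: T x.
Proof. by have := linT c x 0; rewrite linear0_of !addr0. Qed.

Lemma linearN_of x : T (- x) = - T x.
Proof. by rewrite -scaleN1r linearZ_of scaleN1r. Qed.

Lemma linearB_of x y : T (x - y) = T x - T y.
Proof. by rewrite linearD_of linearN_of. Qed.

Lemma linear_sum_of (I : Type) (s : seq I) (f : I -> V) :
  T (\sum_(i <- s) f i) = \sum_(i <- s) T (f i).
Proof.
elim: s => [|i s IH]; first by rewrite !big_nil linear0_of.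
by rewrite !big_cons linearD_of IH.
Qed.

End LinearMaps.

Section Metric.
Context (R : realType) (V : hilbertType R).
Implicit Types x y : V.

Lemma ball_hnorm x y (e : R) : 0 < e -> ball x e%:C y <-> hnorm (x - y) < e.
Proof. by move=> e0; rewrite -ball_normE /ball_ /= normE ltcR. Qed.

Lemma complex_pos (e : R[i]) : 0 < e -> exists2 r : R, 0 < r & e = r%:C.
Proof.
move=> e0; exists (complex.Re e); last by rewrite RRe_real // gtr0_real.
by rewrite -ltcR RRe_real // gtr0_real.
Qed.

Lemma hilbert_complete (u : nat -> V) :
  (forall e : R, 0 < e -> exists N, forall i j, (N <= i)%N -> (N <= j)%N ->
     hnorm (u i - u j) < e) ->
  exists l, forall e : R, 0 < e -> exists N, forall i, (N <= i)%N ->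
     hnorm (u i - l) < e.
Proof.
move=> hu.
have cu : cauchy (u @ \oo).
  apply/cauchy_ballP => e0 /complex_pos[e ep ->].
  have [N hN] := hu e ep.
  rewrite near_map2; exists ([set i | N <= i]%N, [set i | N <= i]%N).
    by split; exists N.
  by move=> -[i j] /= [Ni Nj]; apply/ball_hnorm => //; exact: hN.
have /cauchy_cvg/cvg_ex[l hl] := cu.
exists l => e ep.
have /cvg_ballP/(_ e%:C) := hl; rewrite ltcR => /(_ ep)[N _ hN].
exists N => i Ni; rewrite hnormC; apply/ball_hnorm => //; exact: hN.
Qed.

Lemma closed_hnorm (Y : set V) :
  (forall x, (forall e : R, 0 < e -> exists2 y, Y y & hnorm (y - x) < e) -> Y x) ->
  closed Y.
Proof.
move=> h x clx; apply: h => e e0.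
have [|y [Yy]] := clx (ball x e%:C); first by apply: nbhsx_ballx; rewrite ltcR.
by move=> /ball_hnorm bxy; exists y => //; rewrite hnormC; exact: bxy.
Qed.

Lemma dense_hnorm (D : set V) x (e : R) :
  dense D -> 0 < e -> exists2 y, D y & hnorm (y - x) < e.
Proof.
move=> dD e0.
have [|y [by_ Dy]] := dD (ball x e%:C)° _ (@open_interior _ _).
  exists x; apply: nbhsx_ballx; by rewrite ltcR.
exists y => //; rewrite hnormC; apply/ball_hnorm => //; exact: interior_subset by_.
Qed.

End Metric.

Section BoundedOperators.
Context (R : realType).

Lemma bounded_opP (V W : hilbertType R) (T : V -> W) :
  bounded_op T <->
  linear T /\ exists2 M : R, 0 <= M & forall x, hnorm (T x) <= M * hnorm x.
Proof.
split=> -[linT].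
  move=> cT; split=> //.
  pose f : {linear V -> W} := HB.pack T (GRing.isLinear.Build _ _ _ _ T linT).
  have /linear_boundedP [M0 [M0r hM0]] : bounded_near f (nbhs (0 : V)).
    exact/linear_bounded_continuous.
  (* The bound holds for constants strictly above [M0], which may be negative: hence the maximum
     with 0 and the [+ 1]. *)
  pose M : R := Num.max 0 (complex.Re M0) + 1.
  exists M; first by rewrite /M addr_ge0 // le_max lexx.
  move=> x; rewrite -lecR rmorphM /= -!normE; apply: hM0.
  rewrite -(RRe_real M0r) ltcR /M.
  apply: (@le_lt_trans _ _ (Num.max 0 (complex.Re M0))); first by rewrite le_max lexx orbT.
  by rewrite ltrDl.
move=> [M M0 hM]; split=> //.
pose f : {linear V -> W} := HB.pack T (GRing.isLinear.Build _ _ _ _ T linT).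
have /linear_bounded_continuous : bounded_near f (nbhs (0 : V)).
  apply/linear_boundedP; exists M%:C; split; first by apply/complex_realP; exists M.
  move=> r Mr x; apply: (@le_trans _ _ (M%:C * `|x|)).
    by rewrite !normE -rmorphM lecR.
  by apply: ler_wpM2r => //; exact: ltW.
by [].
Qed.

Lemma bounded_op_lin (V W : hilbertType R) (T : V -> W) : bounded_op T -> linear T.
Proof. by case. Qed.

Lemma bounded_op_id (V : hilbertType R) : bounded_op (@id V).
Proof.
by apply/bounded_opP; split=> //; exists 1 => // x; rewrite mul1r.
Qed.

Lemma bounded_op_comp (U V W : hilbertType R) (S : V -> W) (T : U -> V) :
  bounded_op S -> bounded_op T -> bounded_op (S \o T).
Proof.
move=> /bounded_opP[lS [M M0 hM]] /bounded_opP[lT [N N0 hN]].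
apply/bounded_opP; split; first by move=> c x y /=; rewrite lT lS.
exists (M * N); first exact: mulr_ge0.
move=> x /=; apply: (le_trans (hM _)); rewrite -mulrA.
exact: ler_wpM2l.
Qed.

Lemma bounded_op_lcomb (V W : hilbertType R) (c : R[i]) (S T : V -> W) :
  bounded_op S -> bounded_op T -> bounded_op ((c \*: S) \+ T).
Proof.
move=> /bounded_opP[lS [M M0 hM]] /bounded_opP[lT [N N0 hN]].
apply/bounded_opP; split.
  by move=> a x y /=; rewrite lS lT !scalerDr !scalerA mulrC addrACA.
exists (complex.Re `|c| * M + N).
  by rewrite addr_ge0 // mulr_ge0 // Re_norm_ge0.
move=> x /=; apply: (le_trans (ler_hnormD _ _)); rewrite mulrDl lerD //.
by rewrite hnormZ -mulrA ler_wpM2l // Re_norm_ge0.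
Qed.

End BoundedOperators.

(** * Orthogonal projection, Riesz representation and adjoints *)

Section Riesz.
Context (R : realType) (V : hilbertType R).

Lemma hilbert_projection (Y : set V) (x : V) :
  Y 0 -> (forall (r : R) a b, Y a -> Y b -> Y (a + r%:C *: b)) ->
  exists y0, (forall e : R, 0 < e -> exists2 y, Y y & hnorm (y - y0) < e) /\
    forall y, Y y -> rip (x - y0) y = 0.
Proof.
move=> Y0 Ylin.
have sq_lt (a e : R) : 0 <= a -> 0 < e -> (a ^+ 2 < e ^+ 2) = (a < e).
  by move=> a0 e0; rewrite ltr_pXn2r // ?nnegrE // ltW.
have sqrt_lt (a e : R) : 0 <= a -> 0 < e -> a < Num.sqrt e -> a ^+ 2 < e.
  by move=> a0 e0 h; rewrite -(sqr_sqrtr (ltW e0)) sq_lt // sqrtr_gt0.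
have [|||||||y0 [h1 h2]] := @form_projection _ V (@rip R V) _ _ _ _ Y x.
- exact: ripC.
- exact: ripDl.
- exact: ripZl.
- by move=> v; rewrite ripE sqr_ge0.
- move=> u hu; have [|l hl] := @hilbert_complete R V u.
    move=> e e0; have [N hN] := hu (e ^+ 2) (exprn_gt0 _ e0).
    by exists N => i j Ni Nj; rewrite -sq_lt // ?hnorm_ge0 // -ripE hN.
  exists l => e e0; have [|N hN] := hl (Num.sqrt e); first by rewrite sqrtr_gt0.
  exists N => i Ni; rewrite ripE sqrt_lt // ?hnorm_ge0 //; exact: hN.
- by [].
- by [].
exists y0; split=> // e e0; have [y Yy hy] := h1 (e ^+ 2) (exprn_gt0 _ e0).
by exists y => //; rewrite -sq_lt // ?hnorm_ge0 // -ripE.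
Qed.

Lemma rip_CS (x y : V) : rip x y <= hnorm x * hnorm y.
Proof.
have := @form_CS _ V (@rip R V) (@ripC _ _) (@ripDl _ _) (@ripZl _ _) _ x y.
rewrite !ripE -exprMn => h.
have {}h : rip x y ^+ 2 <= (hnorm x * hnorm y) ^+ 2.
  by apply: h => v; rewrite ripE sqr_ge0.
apply: (le_trans (ler_norm _)); rewrite -(@ler_pXn2r _ 2) //.
- by rewrite real_normK // num_real.
- by rewrite nnegrE mulr_ge0 // hnorm_ge0.
Qed.

(** The representing vector is a multiple of the component, orthogonal to the kernel of [f], of a
    vector outside it. A one-sided bound suffices because [f (- x) = - f x]. *)
Lemma rip_riesz (f : V -> R) (M : R) :
  (forall x y, f (x + y) = f x + f y) ->
  (forall (r : R) x, f (r%:C *: x) = r * f x) ->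
  (forall x, f x <= M * hnorm x) ->
  exists z, forall x, f x = rip x z.
Proof.
move=> fD fZ fM.
have f0 : f 0 = 0 by have := fZ 0 0; rewrite scaler0 mul0r.
have fN x : f (- x) = - f x.
  by apply/eqP; rewrite -addr_eq0 addrC -fD subrr f0.
have [[x0 x0n]|] := pselect (exists x, f x <> 0); last first.
  move=> h; exists 0 => x; rewrite rip0r; apply: contrapT => hx; apply: h.
  by exists x.
have [|r a b fa fb|y0 [y0cl y0o]] := @hilbert_projection [set x | f x = 0] x0.
- exact: f0.
- by rewrite /= fD fZ fa fb mulr0 addr0.
(* [y0] is only a limit of points of the kernel, so the bound is applied near [y0] and near [- y0].
   The case [M <= 0] is separate since the estimate divides by [M]. *)
have fy0 : f y0 = 0.
  apply/eqP; rewrite eq_le; apply/andP; split.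
    apply/ler_addgt0Pr => e e0; rewrite add0r.
    have [M0|M0] := leP M 0.
      have := fM y0; move=> h; apply: (le_trans h); apply: (@le_trans _ _ 0); last exact: ltW.
      by apply: mulr_le0_ge0 => //; exact: hnorm_ge0.
    have [y fy hy] := y0cl (e / M) (divr_gt0 e0 M0).
    have -> : f y0 = f (y0 - y) by rewrite fD fN fy oppr0 addr0.
    apply: (le_trans (fM _)); rewrite hnormC -ler_pdivlMl // mulrC; exact: ltW.
  rewrite -oppr_le0 -fN.
  apply/ler_addgt0Pr => e e0; rewrite add0r.
  have [M0|M0] := leP M 0.
    have := fM (- y0); move=> h; apply: (le_trans h); apply: (@le_trans _ _ 0); last exact: ltW.
    by apply: mulr_le0_ge0 => //; exact: hnorm_ge0.
  have [y fy hy] := y0cl (e / M) (divr_gt0 e0 M0).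
  have -> : f (- y0) = f (y - y0) by rewrite fD fN fy add0r.
  apply: (le_trans (fM _)); rewrite -ler_pdivlMl // mulrC; exact: ltW.
set u := x0 - y0.
have fu : f u = f x0 by rewrite fD fN fy0 oppr0 addr0.
have un0 : rip u u != 0.
  by apply/eqP => /rip_eq0 u0; apply: x0n; rewrite -fu u0.
have fx0 : f x0 != 0 by apply/eqP.
exists ((f u / rip u u)%:C *: u) => x.
rewrite ripZr.
have : rip u (x + (- (f x / f u))%:C *: u) = 0.
  by apply: y0o; rewrite /= fD fZ fu; field.
rewrite ripDr ripZr (ripC u x) => /eqP; rewrite addr_eq0 mulNr opprK => /eqP ->.
by field; rewrite fu fx0 un0.
Qed.

End Riesz.

Section Adjoints.
Context (R : realType).

(** The real Riesz vector is enough: complex linearity of [S] follows by moving scalars across [rip]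
    with [rip_conj] and through [T]. *)
Lemma adjoint_exists (V W : hilbertType R) (T : V -> W) : bounded_op T ->
  exists2 S : W -> V, linear S & forall x y, rip (T x) y = rip x (S y).
Proof.
move=> /bounded_opP[lT [M M0 hM]].
have ex y : exists z, forall x, rip (T x) y = rip x z.
  apply: (@rip_riesz R V _ (M * hnorm y)).
  - by move=> x x'; rewrite (linearD_of lT) ripDl.
  - by move=> r x; rewrite (linearZ_of lT) ripZl.
  - move=> x; apply: (le_trans (rip_CS _ _)).
    by rewrite mulrAC ler_wpM2r // hnorm_ge0.
have [S hS] := choice ex.
exists S => [c x y|x y]; last exact: hS.
apply: rip_inj => z; rewrite ripDl !(ripC _ z) -hS ripDr rip_conjr.
by rewrite -(linearZ_of lT) !hS -rip_conjr.
Qed.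

Lemma adjoint_bound (V W : hilbertType R) (T : V -> W) (S : W -> V) (M : R) :
  0 <= M -> (forall x, hnorm (T x) <= M * hnorm x) ->
  (forall x y, rip (T x) y = rip x (S y)) ->
  forall y, hnorm (S y) <= M * hnorm y.
Proof.
move=> M0 hM hS y.
have := hnorm_ge0 (S y); rewrite le_eqVlt => /orP[/eqP <-|s0].
  by rewrite mulr_ge0 // hnorm_ge0.
rewrite -(ler_pM2l s0) -expr2 -ripE -hS; apply: (le_trans (rip_CS _ _)).
by rewrite mulrCA mulrA ler_wpM2r // hnorm_ge0.
Qed.

Lemma bounded_op_adjoint (V W : hilbertType R) (T : V -> W) : bounded_op T ->
  exists2 S : W -> V, bounded_op S & forall x y, rip (T x) y = rip x (S y).
Proof.
move=> bT; have [S lS hS] := adjoint_exists bT; exists S => //.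
have /bounded_opP[_ [M M0 hM]] := bT.
by apply/bounded_opP; split=> //; exists M => //; exact: (adjoint_bound M0 hM hS).
Qed.

Lemma adjoint_ripP (V : hilbertType R) (T S : V -> V) : linear T ->
  adjoint T S <-> forall x y, rip (T x) y = rip x (S y).
Proof.
move=> lT; split=> [h x y|h x y]; first by rewrite /rip h.
by rewrite !inner_ripE -(linearZ_of lT) !h.
Qed.

End Adjoints.

(** * Strong convergence of sequences of vectors and operators *)

Section StrongConvergence.
Context (R : realType).
Implicit Types U V : hilbertType R.

Definition hcvg V (u : nat -> V) (l : V) := (fun n => hnorm (u n - l)) @ \oo --> (0 : R).

Lemma hcvgP V (u : nat -> V) l :
  hcvg u l <-> forall e : R, 0 < e -> exists N, forall i, (N <= i)%N -> hnorm (u i - l) < e.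
Proof.
split=> [h e e0|h].
  have /cvgrPdist_lt/(_ e e0)[N _ hN] := h; exists N => i Ni.
  by have := hN i Ni; rewrite /= sub0r normrN ger0_norm // hnorm_ge0.
apply/cvgrPdist_lt => e e0; have [N hN] := h e e0; exists N => // i Ni.
by rewrite /= sub0r normrN ger0_norm ?hnorm_ge0 // hN.
Qed.

Lemma hcvg_unique V (u : nat -> V) l l' : hcvg u l -> hcvg u l' -> l = l'.
Proof.
move=> /hcvgP h /hcvgP h'; apply/eqP; rewrite -subr_eq0; apply/eqP/hnorm_eq0.
apply/eqP; rewrite eq_le hnorm_ge0 andbT; apply/ler_addgt0Pr => e e0; rewrite add0r.
have e2 : 0 < e / 2 by lra.
have [N hN] := h _ e2; have [N' hN'] := h' _ e2.
have h1 := hN _ (leq_maxl N N'); have h2 := hN' _ (leq_maxr N N').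
rewrite hnormC in h1.
have := ler_hnormD (l - u (maxn N N')) (u (maxn N N') - l').
rewrite addrA subrK => h3; lra.
Qed.

Lemma hcvg_le V (u : nat -> V) l (b : nat -> R) :
  (forall n, hnorm (u n - l) <= b n) -> b @ \oo --> (0 : R) -> hcvg u l.
Proof.
move=> hb cb; apply: (@squeeze_cvgr _ _ _ _ (fun=> 0) b) => //.
  by apply: nearW => n; rewrite hnorm_ge0 hb.
exact: cvg_cst.
Qed.

Lemma hcvg_cst V (l : V) : hcvg (fun=> l) l.
Proof.
rewrite /hcvg subrr hnorm0; exact: cvg_cst.
Qed.

Lemma hcvgD V (u v : nat -> V) l m : hcvg u l -> hcvg v m ->
  hcvg (fun n => u n + v n) (l + m).
Proof.
move=> hu hv; apply: (@hcvg_le _ _ _ (fun n => hnorm (u n - l) + hnorm (v n - m))).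
  by move=> n; rewrite opprD addrACA ler_hnormD.
by rewrite -[0 in X in _ --> X](addr0 (0 : R)); exact: cvgD.
Qed.

Lemma hcvgZ V (c : R[i]) (u : nat -> V) l : hcvg u l ->
  hcvg (fun n => c *: u n) (c *: l).
Proof.
move=> hu; apply: (@hcvg_le _ _ _ (fun n => complex.Re `|c| * hnorm (u n - l))).
  by move=> n; rewrite -scalerBr hnormZ.
by rewrite -[0 in X in _ --> X](mulr0 (complex.Re `|c|)); exact: cvgMr.
Qed.

(** Write [T n (v n) - m] as [T n (v n - l) + (T n l - m)]: the uniform bound [C] controls the first
    term. *)
Lemma hcvg_comp U V (T : nat -> U -> V) (C : R) (v : nat -> U) l m :
  (forall n, linear (T n)) -> (forall n x, hnorm (T n x) <= C * hnorm x) ->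
  hcvg v l -> hcvg (T^~ l) m -> hcvg (fun n => T n (v n)) m.
Proof.
move=> lT hC hv hT.
apply: (@hcvg_le _ _ _ (fun n => C * hnorm (v n - l) + hnorm (T n l - m))).
  move=> n; have -> : T n (v n) - m = T n (v n - l) + (T n l - m).
    by rewrite (linearB_of (lT n)) addrA subrK.
  by apply: (le_trans (ler_hnormD _ _)); rewrite lerD2r.
rewrite -[0 in X in _ --> X](addr0 (0 : R)); apply: cvgD => //.
by rewrite -[0 in X in _ --> X](mulr0 C); exact: cvgMr.
Qed.

Lemma hcvg_op U V (T : U -> V) u l : bounded_op T -> hcvg u l ->
  hcvg (fun n => T (u n)) (T l).
Proof.
move=> /bounded_opP[lT [C _ hC]] hu; apply: (@hcvg_comp _ _ (fun=> T) C _ l) => //.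
exact: hcvg_cst.
Qed.

Lemma hcvg_hnorm_le V (u : nat -> V) l (C : R) :
  (forall n, hnorm (u n) <= C) -> hcvg u l -> hnorm l <= C.
Proof.
move=> hC /hcvgP hu; apply/ler_addgt0Pr => e e0.
have [N hN] := hu e e0; have := hN N (leqnn _); rewrite hnormC => h.
have := ler_hnormD (l - u N) (u N); rewrite subrK; have := hC N; lra.
Qed.

Lemma hcvg_rip V (u : nat -> V) l y : hcvg u l -> (fun n => rip (u n) y) @ \oo --> rip l y.
Proof.
move=> hu; apply/cvgrPdist_le => e e0.
have hy : 0 < hnorm y + 1 by rewrite ltr_wpDl // hnorm_ge0.
have /hcvgP/(_ (e / (hnorm y + 1)))[|N hN] := hu; first exact: divr_gt0.
exists N => // n Nn /=; have := hN n Nn; rewrite ltr_pdivlMr // => h.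
have b : forall a : V, rip a y <= hnorm a * (hnorm y + 1).
  by move=> a; apply: (le_trans (rip_CS _ _)); rewrite ler_wpM2l ?hnorm_ge0 // lerDl.
rewrite -ripBl ler_norml; apply/andP; split.
  by rewrite lerNl -ripNl opprB; apply: (le_trans (b _)); exact: ltW.
by apply: (le_trans (b _)); rewrite hnormC; exact: ltW.
Qed.

Lemma nondecreasing_bounded_cauchy (a : nat -> R) (A : R) :
  (forall n, a n <= a n.+1) -> (forall n, a n <= A) ->
  forall e : R, 0 < e -> exists N, forall i j, (N <= i)%N -> (i <= j)%N -> a j - a i < e.
Proof.
move=> amono aA e e0.
have mono : {homo a : n m / (n <= m)%N >-> n <= m} by apply/nondecreasing_seqP.
have ca : cvgn a.
  by apply: nondecreasing_is_cvgn => //; exists A => _ [n _ <-].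
have /cvgrPdist_lt/(_ e e0)[N _ hN] := ca.
exists N => i j Ni ij; have := hN i Ni; rewrite /= ltr_norml => /andP[_ h].
have := nondecreasing_cvgn_le mono ca j; lra.
Qed.

(** Majorant principle: [a] is a bounded monotone scalar sequence whose increments dominate those of
    [u]. It serves both the Neumann series and the square root iteration. *)
Lemma op_cauchy_limit U V (u : nat -> U -> V) (a : nat -> R) (A : R) :
  (forall n, linear (u n)) ->
  (forall n, a n <= a n.+1) -> (forall n, a n <= A) ->
  (forall n x, hnorm (u n.+1 x - u n x) <= (a n.+1 - a n) * hnorm x) ->
  exists2 T, linear T & forall x, hcvg (u^~ x) (T x).
Proof.
move=> lu amono aA du.
have dij x i j : (i <= j)%N -> hnorm (u j x - u i x) <= (a j - a i) * hnorm x.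
  elim: j => [|j IH]; first by rewrite leqn0 => /eqP ->; rewrite !subrr hnorm0 mul0r.
  rewrite leq_eqVlt => /orP[/eqP ->|]; first by rewrite !subrr hnorm0 mul0r.
  rewrite ltnS => ij.
  have := ler_hnormD (u j.+1 x - u j x) (u j x - u i x); rewrite addrA subrK.
  move=> h; apply: (le_trans h); apply: (le_trans (lerD (du j x) (IH ij))).
  by rewrite -mulrDl addrA subrK.
have ex x : exists l, hcvg (u^~ x) l.
  have [|l hl] := @hilbert_complete R V (u^~ x); last by exists l; apply/hcvgP.
  move=> e e0.
  have hx : 0 < hnorm x + 1 by rewrite ltr_wpDl // hnorm_ge0.
  have [|N hN] := nondecreasing_bounded_cauchy amono aA (e := e / (hnorm x + 1)).
    exact: divr_gt0.
  have key i j : (N <= i)%N -> (i <= j)%N -> hnorm (u j x - u i x) < e.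
    move=> Ni ij; apply: (le_lt_trans (dij x i j ij)).
    have := hN i j Ni ij; rewrite ltr_pdivlMr //; apply: le_lt_trans.
    rewrite ler_wpM2l ?lerDl // subr_ge0.
    by move/nondecreasing_seqP: amono; apply.
  exists N => i j Ni Nj; have [ij|/ltnW ji] := leqP i j; last exact: key.
  by rewrite hnormC; exact: key.
have [T hT] := choice ex.
exists T => // c x y; apply: (hcvg_unique (hT _)).
have := hcvgD (hcvgZ c (hT x)) (hT y); rewrite /hcvg.
by under eq_fun do rewrite -lu.
Qed.

End StrongConvergence.

(** * Strongly sequentially closed *-algebras *)

(** [sot_lim] asks only for uniformly bounded sequences, which is what limits of measurable fields
    can provide. *)
Record sot_star_algebra (R : realType) (V : hilbertType R) (M : set (V -> V)) : Prop := {
  sot_bounded : forall T, M T -> bounded_op T;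
  sot_id : M id;
  sot_lcomb : forall c S T, M S -> M T -> M ((c \*: S) \+ T);
  sot_comp : forall S T, M S -> M T -> M (S \o T);
  sot_adj : forall T S, M T -> bounded_op S -> (forall x y, rip (T x) y = rip x (S y)) -> M S;
  sot_lim : forall (u : nat -> V -> V) T (C : R), (forall n, M (u n)) -> linear T ->
    (forall n x, hnorm (u n x) <= C * hnorm x) -> (forall x, hcvg (u^~ x) (T x)) -> M T
}.

Section StarAlgebra.
Context (R : realType) (V : hilbertType R).

Lemma sot_star_algebra_bounded_op : sot_star_algebra (@bounded_op R V V).
Proof.
split=> //.
- exact: bounded_op_id.
- by move=> c S T; exact: bounded_op_lcomb.
- by move=> S T; exact: bounded_op_comp.
- move=> u T C hu lT hC hT; apply/bounded_opP; split=> //; exists `|C| => // x.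
  apply: (hcvg_hnorm_le _ (hT x)) => n; apply: (le_trans (hC n x)).
  by rewrite ler_wpM2r ?hnorm_ge0 // ler_norm.
Qed.

Context (M : set (V -> V)) (hM : sot_star_algebra M).

Lemma sot_zero : M (fun=> 0).
Proof.
have := sot_lcomb hM (-1) (sot_id hM) (sot_id hM); congr M.
by apply/funext => x /=; rewrite scaleN1r addNr.
Qed.

Lemma sot_scale c T : M T -> M (fun x => c *: T x).
Proof.
move=> MT; have := sot_lcomb hM c MT sot_zero; congr M.
by apply/funext => x /=; rewrite addr0.
Qed.

Lemma sot_add S T : M S -> M T -> M (fun x => S x + T x).
Proof.
move=> MS MT; have := sot_lcomb hM 1 MS MT; congr M.
by apply/funext => x /=; rewrite scale1r.
Qed.

Lemma sot_sub S T : M S -> M T -> M (fun x => S x - T x).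
Proof.
move=> MS MT; have := sot_add MS (sot_scale (-1) MT); congr M.
by apply/funext => x /=; rewrite scaleN1r.
Qed.

(** [u n] is the sum of the first [n] powers of [A] in Horner form, and [a n] the matching geometric
    sum. The partial sums lie in [M] with the common bound [(1 - r)^-1], so the inverse of [1 - A]
    stays in [M]. *)
Lemma neumann (A : V -> V) (r : R) : M A -> r < 1 -> 0 <= r ->
  (forall x, hnorm (A x) <= r * hnorm x) ->
  exists S, [/\ M S, forall x, S x - A (S x) = x & forall x, S (x - A x) = x].
Proof.
move=> MA r1 r0 hA; have bA := sot_bounded hM MA; have lA := bounded_op_lin bA.
pose u := fix u n : V -> V := if n is n'.+1 then fun x => x + A (u n' x) else fun=> 0.
have Mu n : M (u n).
  elim: n => [|n IH]; first exact: sot_zero.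
  exact: (sot_add (sot_id hM) (sot_comp hM MA IH)).
have lu n : linear (u n) by apply/bounded_op_lin/(sot_bounded hM).
pose a := fix a n : R := if n is n'.+1 then 1 + r * a n' else 0.
have adiff n : a n.+1 - a n = r ^+ n.
  elim: n => [|n IH]; first by rewrite /= mulr0 addr0 subr0.
  rewrite exprS -IH /=; ring.
have amono n : a n <= a n.+1 by rewrite -subr_ge0 adiff exprn_ge0.
have aA n : a n <= (1 - r)^-1.
  elim: n => [|n IH] /=; first by rewrite invr_ge0 subr_ge0 ltW.
  apply: (@le_trans _ _ (1 + r * (1 - r)^-1)); first by rewrite lerD2l ler_wpM2l.
  by rewrite le_eqVlt; apply/orP; left; apply/eqP; field; rewrite gt_eqF // subr_gt0.
have du n x : hnorm (u n.+1 x - u n x) <= (a n.+1 - a n) * hnorm x.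
  rewrite adiff; elim: n => [|n IH].
    by rewrite /= (linear0_of lA) addr0 subr0 expr0 mul1r.
  rewrite [u n.+2]/= [u n.+1]/= opprD addrACA subrr add0r -(linearB_of lA).
  apply: (le_trans (hA _)); rewrite exprS -mulrA; exact: ler_wpM2l.
have [S lS hS] := op_cauchy_limit lu amono aA du.
have ub n x : hnorm (u n x) <= (1 - r)^-1 * hnorm x.
  apply: (@le_trans _ _ (a n * hnorm x)); last by rewrite ler_wpM2r ?hnorm_ge0.
  elim: n => [|n IH]; first by rewrite /= hnorm0 mul0r.
  have := ler_hnormD (u n.+1 x - u n x) (u n x); rewrite subrK => h.
  by apply: (le_trans h); have := du n x; rewrite mulrBl; lra.
have SE x : S x = x + A (S x).
  apply: (@hcvg_unique _ _ (fun n => u n.+1 x)).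
    by have /hcvgP h := hS x; apply/hcvgP => e e0; have [N hN] := h e e0;
       exists N => i Ni; exact/hN/leqW.
  exact: (hcvgD (hcvg_cst x) (hcvg_op bA (hS x))).
have uA n x : u n (A x) = A (u n x).
  elim: n => [|n IH]; first by rewrite /= (linear0_of lA).
  by rewrite /= IH (linearD_of lA).
have SA x : S (A x) = A (S x).
  apply: (@hcvg_unique _ _ (fun n => u n (A x))); first exact: hS.
  have := hcvg_op bA (hS x); congr hcvg; apply/funext => n; exact/esym/uA.
exists S; split.
- exact: (sot_lim hM Mu lS ub hS).
- by move=> x; rewrite {1}SE addrK.
- by move=> x; rewrite (linearB_of lS) SA {1}SE addrK.
Qed.

(** Cauchy-Schwarz for the positive form [rip (A x) y], taken at [y = A x], bounds the fourth power
    of [hnorm (A x)] by [r * hnorm x ^+ 2] times [r * hnorm (A x) ^+ 2]. *)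
Lemma selfadjoint_bound (A : V -> V) (r : R) : linear A ->
  (forall x y, rip (A x) y = rip x (A y)) ->
  (forall x, 0 <= rip (A x) x) -> (forall x, rip (A x) x <= r * hnorm x ^+ 2) ->
  0 <= r -> forall x, hnorm (A x) <= r * hnorm x.
Proof.
move=> lA sA A0 Ar r0 x.
have := @form_CS _ V (fun x y => rip (A x) y) _ _ _ A0 x (A x).
rewrite /= ripE => CS.
have {}CS : (hnorm (A x) ^+ 2) ^+ 2 <= rip (A x) x * rip (A (A x)) (A x).
  apply: CS => [v w|v w z|s v w]; first by rewrite sA ripC.
    by rewrite (linearD_of lA) ripDl.
  by rewrite (linearZ_of lA) ripZl.
have {}CS : (hnorm (A x) ^+ 2) ^+ 2 <= (r * hnorm x ^+ 2) * (r * hnorm (A x) ^+ 2).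
  by apply: (le_trans CS); rewrite ler_pM.
have := hnorm_ge0 (A x); rewrite le_eqVlt => /orP[/eqP <-|Ax0].
  by rewrite mulr_ge0 // hnorm_ge0.
rewrite -(@ler_pXn2r _ 2) ?nnegrE ?mulr_ge0 ?hnorm_ge0 //.
have h2 : 0 < hnorm (A x) ^+ 2 by rewrite exprn_gt0.
rewrite -(ler_pM2r h2) -expr2; apply: (le_trans CS).
by rewrite le_eqVlt; apply/orP; left; apply/eqP; ring.
Qed.

(** Rescaled by [D], the operator [G] is [1 - A] with [A] between 0 and [1 - c / D], so the Neumann
    series inverts it. *)
Lemma sot_inverse (G : V -> V) (c C : R) : M G ->
  (forall x y, rip (G x) y = rip x (G y)) -> 0 < c ->
  (forall x, c * hnorm x ^+ 2 <= rip (G x) x) ->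
  (forall x, rip (G x) x <= C * hnorm x ^+ 2) ->
  exists S, [/\ M S, forall x, G (S x) = x & forall x, S (G x) = x].
Proof.
move=> MG sG c0 Gc GC.
(* [D >= C] makes [A] positive; [D >= c > 0] makes its bound [1 - c / D] nonnegative. *)
pose D := Num.max c C; have D0 : 0 < D by rewrite lt_max c0.
have lG := bounded_op_lin (sot_bounded hM MG).
pose A := fun x => x - (D^-1)%:C *: G x.
have MA : M A by exact: (sot_sub (sot_id hM) (sot_scale _ MG)).
have lA := bounded_op_lin (sot_bounded hM MA).
have ripA x y : rip (A x) y = rip x y - D^-1 * rip (G x) y by rewrite ripBl ripZl.
have r0 : 0 <= 1 - c / D by rewrite subr_ge0 ler_pdivrMr // mul1r le_max lexx.
have [|||S [MS S1 S2]] := @neumann A (1 - c / D) MA.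
- by rewrite gtrDl oppr_lt0 divr_gt0.
- exact: r0.
- apply: selfadjoint_bound => // [x y|x|x].
  + by rewrite ripA sG (ripC x (A y)) ripA (ripC y) (ripC (G y)).
  + rewrite ripA ripE subr_ge0 mulrC ler_pdivrMr //; apply: (le_trans (GC x)).
    by rewrite mulrC ler_wpM2l ?sqr_ge0 // le_max lexx orbT.
  + rewrite ripA ripE mulrBl mul1r lerD2l lerN2 mulrAC mulrC ler_wpM2l // invr_ge0 ltW //.
have GA x : G x = D%:C *: (x - A x).
  by rewrite /A opprB addrC subrK scalerA -rmorphM /= divff ?scale1r // gt_eqF.
have lS := bounded_op_lin (sot_bounded hM MS).
exists (fun x => (D^-1)%:C *: S x); split; first exact: sot_scale.
- move=> x; rewrite (linearZ_of lG) GA S1 scalerA -rmorphM /= mulVf ?scale1r //.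
  by rewrite gt_eqF.
- move=> x; rewrite GA (linearZ_of lS) S2 scalerA -rmorphM /= mulVf ?scale1r //.
  by rewrite gt_eqF.
Qed.

End StarAlgebra.

(** * Square roots and the lemma of Schur *)

Section SquareRoot.
Context (R : realType) (V : hilbertType R).

(* The scalar recursion [y_{n+1} = (1 + y_n^2) / 2] dominates the operator
   recursion [Y_{n+1} = (A + Y_n^2) / 2], which therefore converges in norm to
   a solution of [(1 - Y)^2 = 1 - A]. *)
Lemma sqrt_contraction (A : V -> V) : bounded_op A ->
  (forall x, hnorm (A x) <= hnorm x) ->
  (forall x y, rip (A x) y = rip x (A y)) ->
  exists Y, [/\ bounded_op Y, forall x, hnorm (Y x) <= hnorm x,
    forall x y, rip (Y x) y = rip x (Y y),
    forall x, 2%:C *: Y x = A x + Y (Y x) &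
    forall T, bounded_op T -> (forall x, T (A x) = A (T x)) ->
      forall x, T (Y x) = Y (T x)].
Proof.
move=> bA hA sA; have lA := bounded_op_lin bA.
pose h : R[i] := (2^-1)%:C.
pose u := fix u n : V -> V :=
  if n is n'.+1 then fun x => h *: (A x + u n' (u n' x)) else fun=> 0.
pose a := fix a n : R := if n is n'.+1 then (1 + a n' ^+ 2) / 2 else 0.
have a01 n : 0 <= a n <= 1.
  elim: n => [|n /andP[h0 h1]] /=; first by rewrite lexx ler01.
  by apply/andP; split; nra.
have amono n : a n <= a n.+1.
  by rewrite /=; have := sqr_ge0 (a n - 1); rewrite sqrrB1; lra.
have bu n : bounded_op (u n).
  elim: n => [|n IH]; first exact: (sot_zero (sot_star_algebra_bounded_op V)).
  apply: (sot_scale (sot_star_algebra_bounded_op V)).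
  by apply: (sot_add (sot_star_algebra_bounded_op V)) => //; exact: bounded_op_comp.
have lu n : linear (u n) by exact: bounded_op_lin.
have su n x y : rip (u n x) y = rip x (u n y).
  elim: n x y => [|n IH] x y; first by rewrite rip0l rip0r.
  by rewrite /= /h ripZl ripZr ripDl ripDr sA !IH.
have ubd n x : hnorm (u n x) <= a n * hnorm x.
  elim: n x => [|n IH] x; first by rewrite /= hnorm0 mul0r.
  rewrite /= /h hnormZr ger0_norm //.
  have h1 := ler_hnormD (A x) (u n (u n x)); have h2 := hA x.
  have h3 := IH (u n x); have h4 : a n * hnorm (u n x) <= a n * (a n * hnorm x).
    by apply: ler_wpM2l => //; case/andP: (a01 n).
  have -> : (1 + a n ^+ 2) / 2 * hnorm x = 2^-1 * (hnorm x + a n * (a n * hnorm x)) by field.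
  rewrite ler_wpM2l //; lra.
have du n x : hnorm (u n.+1 x - u n x) <= (a n.+1 - a n) * hnorm x.
  elim: n x => [|n IH] x.
    rewrite /= !subr0 addr0 /h hnormZr ger0_norm //.
    have := hA x; rewrite expr0n addr0 mul1r => ?; lra.
  rewrite [u n.+2]/= [u n.+1 in X in hnorm (_ - X)]/= -scalerBr.
  (* A difference of squares, split without using commutation; the scalar identity for
     [a n.+2 - a n.+1] below is arranged to have the same two terms. *)
  have -> : A x + u n.+1 (u n.+1 x) - (A x + u n (u n x)) =
     (u n.+1 (u n.+1 x) - u n (u n.+1 x)) + (u n (u n.+1 x - u n x)).
    by rewrite (linearB_of (lu n)) opprD addrACA subrr add0r addrA subrK.
  rewrite /h hnormZr ger0_norm //.
  have h1 := ler_hnormD (u n.+1 (u n.+1 x) - u n (u n.+1 x)) (u n (u n.+1 x - u n x)).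
  have h2 := IH (u n.+1 x); have h3 := ubd n (u n.+1 x - u n x).
  have da : 0 <= a n.+1 - a n by rewrite subr_ge0.
  have h4 := ler_wpM2l da (ubd n.+1 x).
  have an0 : 0 <= a n by case/andP: (a01 n).
  have h5 := ler_wpM2l an0 (IH x).
  have -> : a n.+2 - a n.+1 = 2^-1 * ((a n.+1 - a n) * a n.+1 + a n * (a n.+1 - a n)).
    rewrite [a n.+2]/=; have -> : a n ^+ 2 = 2 * a n.+1 - 1 by rewrite /=; field.
    have -> : (a n.+1 - a n) * a n.+1 + a n * (a n.+1 - a n) = a n.+1 ^+ 2 - a n ^+ 2 by ring.
    have -> : a n ^+ 2 = 2 * a n.+1 - 1 by rewrite /=; field.
    by field.
  have E (p q r w : R) : (p * q + r * p) * w = p * (q * w) + r * (p * w) by ring.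
  rewrite -mulrA ler_wpM2l // E; apply: (le_trans h1); apply: lerD.
    exact: (le_trans h2 h4).
  exact: (le_trans h3 h5).
have [Y lY hY] := op_cauchy_limit lu amono (fun n => (andP (a01 n)).2) du.
have ub1 n x : hnorm (u n x) <= 1 * hnorm x.
  by apply: (le_trans (ubd n x)); rewrite ler_wpM2r ?hnorm_ge0 //; case/andP: (a01 n).
have Y1 x : hnorm (Y x) <= hnorm x.
  by apply: (hcvg_hnorm_le _ (hY x)) => n; rewrite -[leRHS]mul1r.
have shift x : hcvg (fun n => u n.+1 x) (Y x).
  have /hcvgP h' := hY x; apply/hcvgP => e e0; have [N hN] := h' e e0.
  by exists N => i Ni; exact/hN/leqW.
exists Y; split=> //.
- by apply/bounded_opP; split=> //; exists 1 => // x; rewrite mul1r.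
- move=> x y; have c1 := hcvg_rip (y := y) (hY x); have c2 := hcvg_rip (y := x) (hY y).
  rewrite (ripC x); have c3 : (fun n => rip (u n x) y) @ \oo --> rip (Y y) x.
    by under eq_fun do rewrite su ripC.
  by rewrite -(cvg_lim _ c1) // (cvg_lim _ c3).
- move=> x; have := hcvgZ 2%:C (shift x) => c1.
  apply: (hcvg_unique c1); have -> : (fun n => 2%:C *: u n.+1 x) = (fun n => A x + u n (u n x)).
    by apply/funext => n; rewrite /= scalerA -rmorphM divff // scale1r.
  apply: hcvgD; first exact: hcvg_cst.
  exact: (hcvg_comp lu ub1 (hY x) (hY (Y x))).
- move=> T bT TA x; have lT := bounded_op_lin bT.
  have Tu n v : T (u n v) = u n (T v).
    elim: n v => [|n IH] v; first by rewrite /= (linear0_of lT).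
    by rewrite /= (linearZ_of lT) (linearD_of lT) TA !IH.
  apply: (hcvg_unique (hcvg_op bT (hY x))).
  by under eq_fun do rewrite Tu; exact: hY.
Qed.

End SquareRoot.

Section Schur.
Context (R : realType) (V : hilbertType R) (M : set (V -> V)).
Hypothesis hM : sot_star_algebra M.
Hypothesis irrM : forall Y : set V, closed_subspace Y ->
  (forall T x, M T -> Y x -> Y (T x)) -> Y = [set 0] \/ Y = setT.

Lemma closed_subspace_equalizer (S T : V -> V) : bounded_op S -> bounded_op T ->
  closed_subspace [set x | S x = T x].
Proof.
move=> bS bT; have lS := bounded_op_lin bS; have lT := bounded_op_lin bT.
split=> [|c x y /= hx hy|].
- by rewrite /= (linear0_of lS) (linear0_of lT).
- by rewrite lS lT hx hy.
have [_ cS] := bS; have [_ cT] := bT.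
apply: closed_hnorm => x hx /=.
have bD : bounded_op (fun v => S v - T v).
  exact: (sot_sub (sot_star_algebra_bounded_op V)).
have /bounded_opP[_ [C C0 hC]] := bD.
apply/eqP; rewrite -subr_eq0; apply/eqP/hnorm_eq0/eqP.
rewrite eq_le hnorm_ge0 andbT; apply/ler_addgt0Pr => e e0; rewrite add0r.
have C1 : 0 < C + 1 by rewrite ltr_wpDl.
have [y hy hyx] := hx (e / (C + 1)) (divr_gt0 e0 C1).
have := hC (y - x); rewrite (linearB_of lS) (linearB_of lT) hy opprB addrC addrA subrK => h.
rewrite hnormC; apply: (le_trans h).
move: hyx; rewrite ltr_pdivlMr // mulrDr mulr1 mulrC => hyx.
by have := hnorm_ge0 (y - x); lra.
Qed.

(* [Z] is the absolute value of [B], so [(Z - B) (Z + B) = 0], and the kernel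
   of [Z - B] is an invariant subspace. *)
Lemma commutant_semidefinite (B : V -> V) : bounded_op B ->
  (forall x, hnorm (B x) <= hnorm x) ->
  (forall x y, rip (B x) y = rip x (B y)) ->
  (forall T, M T -> forall x, T (B x) = B (T x)) ->
  (forall x, 0 <= rip (B x) x) \/ (forall x, rip (B x) x <= 0).
Proof.
move=> bB hB sB cB; have lB := bounded_op_lin bB.
have bdd := sot_star_algebra_bounded_op V.
pose A := fun x => x - B (B x).
have bA : bounded_op A.
  by apply: (sot_sub bdd); [exact: bounded_op_id|exact: bounded_op_comp].
have [||Y [bY Y1 sY YE cY]] := sqrt_contraction bA.
- move=> x.
  have e1 : rip (B (B x)) x = hnorm (B x) ^+ 2 by rewrite sB ripE.
  have e2 : hnorm (A x) ^+ 2 = hnorm x ^+ 2 - 2 * hnorm (B x) ^+ 2 + hnorm (B (B x)) ^+ 2.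
    by rewrite -ripE /A ripBl !ripBr (ripC x (B _)) e1 !ripE; ring.
  have e3 : hnorm (B (B x)) ^+ 2 <= hnorm (B x) ^+ 2.
    by rewrite ler_pXn2r ?nnegrE ?hnorm_ge0.
  have : hnorm (A x) ^+ 2 <= hnorm x ^+ 2.
    by rewrite e2; have := sqr_ge0 (hnorm (B x)); lra.
  by rewrite ler_pXn2r ?nnegrE ?hnorm_ge0.
- by move=> x y; rewrite /A ripBl ripBr !sB.
pose Z := fun x => x - Y x.
have bZ : bounded_op Z by apply: (sot_sub bdd) => //; exact: bounded_op_id.
have lY := bounded_op_lin bY; have lZ := bounded_op_lin bZ.
have ZZ x : Z (Z x) = B (B x).
  rewrite /Z (linearB_of lY) opprB.
  have -> : x - Y x + (Y (Y x) - Y x) = x - (2%:C *: Y x - Y (Y x)).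
    rewrite (_ : 2%:C = 2) ?rmorph_nat // scaler_nat mulr2n.
    by rewrite opprB -addrA; congr (_ + _); rewrite addrCA opprD.
  by rewrite YE addrK /A opprB addrC subrK.
have Z0 x : 0 <= rip (Z x) x.
  rewrite /Z ripBl ripE subr_ge0; apply: (le_trans (rip_CS _ _)).
  by rewrite expr2 ler_wpM2r ?hnorm_ge0.
have comm (T : V -> V) : bounded_op T -> (forall x, T (B x) = B (T x)) ->
    forall x, T (Z x) = Z (T x).
  move=> bT TB x; have lT := bounded_op_lin bT.
  rewrite /Z (linearB_of lT); congr (_ - _); apply: cY => // v.
  by rewrite /A (linearB_of lT) !TB.
have BZ := comm B bB (fun=> erefl).
(* If the kernel of [Z - B] is zero, then [Z + B], whose range it contains, vanishes and [B = - Z].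
   If it is everything, [B = Z]. *)
have [|Yz|Yt] := irrM (closed_subspace_equalizer bZ bB).
- move=> T x MT /= Zx; rewrite -cB // -Zx.
  by rewrite comm //; [exact: (sot_bounded hM)|exact: cB].
- right=> x.
  have : [set x | Z x = B x] (Z x + B x).
    by rewrite /= (linearD_of lZ) (linearD_of lB) ZZ BZ addrC.
  rewrite Yz => /= /eqP; rewrite addrC addr_eq0 => /eqP ->.
  by rewrite ripNl oppr_le0.
- left=> x; have : [set x | Z x = B x] x by rewrite Yt.
  by move=> /= <-.
Qed.

(** For every real [t] the operator [C - t] is semidefinite, so no [t] lies strictly inside the
    numerical range of [C]. The range is thus a single point [s], and polarization turns the
    equality of quadratic forms into [C = s]. *)
Lemma schur_selfadjoint (C : V -> V) : bounded_op C ->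
  (forall x y, rip (C x) y = rip x (C y)) ->
  (forall T, M T -> forall x, T (C x) = C (T x)) ->
  exists r : R, forall x, C x = r%:C *: x.
Proof.
move=> bC sC cC; have /bounded_opP[lC [N N0 hN]] := bC.
have [[x0 x0n]|triv] := pselect (exists x : V, x <> 0); last first.
  exists 0 => x; have triv' y : y = 0 :> V.
    by apply: contrapT => h; apply: triv; exists y.
  by rewrite (triv' (C x)) (triv' x) scaler0.
have dich t : (forall x, t * hnorm x ^+ 2 <= rip (C x) x) \/
              (forall x, rip (C x) x <= t * hnorm x ^+ 2).
  (* This factor makes [B] a contraction; the [+ 1] keeps the denominator positive. *)
  pose k : R := (N + `|t| + 1)^-1.
  have k0' : 0 < N + `|t| + 1 by rewrite ltr_wpDl // addr_ge0.
  have k0 : 0 < k by rewrite invr_gt0.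
  pose B := fun x => k%:C *: (C x - t%:C *: x).
  have bdd := sot_star_algebra_bounded_op V.
  have BE x : rip (B x) x = k * (rip (C x) x - t * hnorm x ^+ 2).
    by rewrite ripZl ripBl ripZl ripE.
  have [||||h|h] := @commutant_semidefinite B.
  - by apply: (sot_scale bdd); apply: (sot_sub bdd) => //; apply/(sot_scale bdd)/bounded_op_id.
  - move=> x; rewrite hnormZr ger0_norm ?(ltW k0) // mulrC ler_pdivrMr //.
    apply: (le_trans (ler_hnormD _ _)); rewrite hnorm_opp hnormZr.
    by have := hN x; have := hnorm_ge0 x; rewrite !mulrDr mulr1 (mulrC _ N) (mulrC _ `|t|); lra.
  - by move=> x y; rewrite ripZl ripZr ripBl ripBr ripZl ripZr sC.
  - move=> T MT x; have lT := bounded_op_lin (sot_bounded hM MT).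
    by rewrite /B (linearZ_of lT) (linearB_of lT) (linearZ_of lT) cC.
  - by left=> x; have := h x; rewrite BE pmulr_rge0 // subr_ge0.
  - by right=> x; have := h x; rewrite BE pmulr_rle0 // subr_le0.
have x0pos : 0 < hnorm x0 ^+ 2.
  rewrite exprn_gt0 // lt_neqAle hnorm_ge0 andbT eq_sym.
  by apply/eqP => /hnorm_eq0.
have CN x : `|rip (C x) x| <= N * hnorm x ^+ 2.
  rewrite ler_norml; apply/andP; split.
    rewrite lerNl -ripNl; apply: (le_trans (rip_CS _ _)).
    by rewrite hnorm_opp expr2 mulrA ler_wpM2r ?hnorm_ge0.
  by apply: (le_trans (rip_CS _ _)); rewrite expr2 mulrA ler_wpM2r ?hnorm_ge0.
pose S := [set t : R | forall x, t * hnorm x ^+ 2 <= rip (C x) x].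
have S0 : S (- N).
  by move=> x; have := CN x; rewrite ler_norml mulNr => /andP[].
have Sub : ubound S N.
  move=> t St; rewrite -(ler_pM2r x0pos); apply: (le_trans (St x0)).
  by have := CN x0; rewrite ler_norml => /andP[].
have hS : has_sup S by split; [exists (- N)|exists N].
pose s := sup S.
have eqs x : rip (C x) x = s * hnorm x ^+ 2.
  have [x0'|xn0] := eqVneq (hnorm x) 0.
    by rewrite (hnorm_eq0 x0') rip0r hnorm0 expr0n mulr0.
  have xpos : 0 < hnorm x ^+ 2 by rewrite exprn_gt0 // lt_neqAle eq_sym xn0 hnorm_ge0.
  apply/eqP; rewrite eq_le; apply/andP; split.
    rewrite -ler_pdivrMr //; apply/ler_addgt0Pr => e e0; rewrite ler_pdivrMr //.
    have [h|] := dich (s + e); last exact.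
    have : s + e <= s by apply: sup_ubound => //; exists N.
    by rewrite gerDl leNgt e0.
  rewrite -ler_pdivlMr //; apply: ge_sup; first by exists (- N).
  by move=> t St; rewrite ler_pdivlMr //; exact: St.
exists s => x; apply: rip_inj => y.
have := eqs (x + y); rewrite -!ripE (linearD_of lC) !(ripDl, ripDr) !eqs !mulrDr -!ripE.
rewrite (sC y x) (ripC y (C x)) ripZl (ripC y x); lra.
Qed.

(** Since [M] is closed under adjoints, the adjoint [E] of [D] commutes with [M] too, and the
    selfadjoint case applies to [D + E] and ['i (D - E)]. *)
Lemma schur (D : V -> V) : bounded_op D ->
  (forall T, M T -> forall x, T (D x) = D (T x)) ->
  exists c : R[i], forall x, D x = c *: x.
Proof.
move=> bD cD; have bdd := sot_star_algebra_bounded_op V.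
have [E bE DE] := bounded_op_adjoint bD.
have lD := bounded_op_lin bD; have lE := bounded_op_lin bE.
have ED x y : rip (E x) y = rip x (D y) by rewrite ripC -DE ripC.
have cE T : M T -> forall x, T (E x) = E (T x).
  move=> MT x; have bT := sot_bounded hM MT.
  have [S bS TS] := bounded_op_adjoint bT.
  have MS := sot_adj hM MT bS TS.
  by apply: rip_inj => y; rewrite TS ED ED -cD // TS.
have [|||r hr] := @schur_selfadjoint (fun x => D x + E x).
- exact: (sot_add bdd).
- by move=> x y; rewrite ripDl ripDr DE ED addrC.
- by move=> T MT x; rewrite (linearD_of (bounded_op_lin (sot_bounded hM MT))) cD // cE.
have [|||r' hr'] := @schur_selfadjoint (fun x => 'i *: (D x - E x)).
- by apply: (sot_scale bdd); exact: (sot_sub bdd).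
- move=> x y; rewrite rip_conj scale_conji.
  rewrite ripNr ripBl DE ED (linearZ_of lE) (linearZ_of lD) scalerBr ripBr; ring.
- move=> T MT x; have lT := bounded_op_lin (sot_bounded hM MT).
  by rewrite (linearZ_of lT) (linearB_of lT) cD // cE.
exists ((2^-1)%:C * (r%:C - 'i * r'%:C)) => x.
have e1 : D x - E x = - ('i * r'%:C) *: x.
  rewrite scaleNr -scalerA -hr' scalerA.
  have -> : 'i * 'i = -1 :> R[i] by rewrite -expr2 sqr_i.
  by rewrite scaleN1r opprK.
rewrite -scalerA scalerDl -e1 -hr addrACA subrr addr0 -mulr2n -[D x *+ 2]scaler_nat scalerA.
by rewrite -(rmorph_nat (real_complex R)) -rmorphM mulVf ?scale1r // pnatr_eq0.
Qed.

End Schur.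

(** * Irreducible algebras contain every bounded operator *)

Section Amplification.
Context (R : realType) (V : hilbertType R) (I : finType).
Implicit Types v w : I -> V.

(** [I -> V] is not made a [hilbertType]: this form is all that the results on positive forms
    require. *)
Definition amp_rip v w : R := \sum_i rip (v i) (w i).

Lemma amp_ripC v w : amp_rip v w = amp_rip w v.
Proof. by apply: eq_bigr => i _; exact: ripC. Qed.

Lemma amp_ripD u v w : amp_rip (u + v) w = amp_rip u w + amp_rip v w.
Proof. by rewrite -big_split; apply: eq_bigr => i _; exact: ripDl. Qed.

Lemma amp_ripZ (r : R) v w : amp_rip (r%:C *: v) w = r * amp_rip v w.
Proof. by rewrite mulr_sumr; apply: eq_bigr => i _; exact: ripZl. Qed.

Lemma amp_rip_ge0 v : 0 <= amp_rip v v.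
Proof. by apply: sumr_ge0 => i _; rewrite ripE sqr_ge0. Qed.

Lemma amp_ripN v w : amp_rip (- v) w = - amp_rip v w.
Proof. by rewrite -sumrN; apply: eq_bigr => i _; exact: ripNl. Qed.

Lemma amp_ripB u v w : amp_rip (u - v) w = amp_rip u w - amp_rip v w.
Proof. by rewrite amp_ripD amp_ripN. Qed.

Lemma amp_rip_comp v i : hnorm (v i) ^+ 2 <= amp_rip v v.
Proof.
rewrite /amp_rip (bigD1 i) //= ripE lerDl.
by apply: sumr_ge0 => j _; rewrite ripE sqr_ge0.
Qed.

Lemma amp_rip_eq0 v : amp_rip v v = 0 -> v = 0.
Proof.
move=> v0; apply/funext => i; apply: hnorm_eq0; apply/eqP.
by rewrite -sqrf_eq0 eq_le sqr_ge0 andbT -v0 amp_rip_comp.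
Qed.

Definition amp_closure (Y : set (I -> V)) : set (I -> V) :=
  [set w | forall e : R, 0 < e -> exists2 y, Y y & amp_rip (y - w) (y - w) < e].

Lemma amp_projection (Y : set (I -> V)) v :
  Y 0 -> (forall (r : R) a b, Y a -> Y b -> Y (a + r%:C *: b)) ->
  exists2 w, amp_closure Y w & forall y, Y y -> amp_rip (v - w) y = 0.
Proof.
move=> Y0 Ylin.
have [|||||||w [h1 h2]] := @form_projection R _ amp_rip _ _ _ _ Y v.
- exact: amp_ripC.
- exact: amp_ripD.
- exact: amp_ripZ.
- exact: amp_rip_ge0.
- move=> u hu.
  have ex i : exists l, hcvg (fun n => u n i) l.
    have [|l hl] := @hilbert_complete R V (fun n => u n i); last by exists l; apply/hcvgP.
    move=> e e0; have [N hN] := hu (e ^+ 2) (exprn_gt0 _ e0).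
    exists N => j k Nj Nk; rewrite -(@ltr_pXn2r _ 2) ?nnegrE ?hnorm_ge0 //; last exact: ltW.
    exact: (le_lt_trans (amp_rip_comp _ i) (hN _ _ Nj Nk)).
  have [l hl] := choice ex; exists l => e e0.
  have : (fun n => \sum_i hnorm (u n i - l i) ^+ 2) @ \oo --> (0 : R).
    rewrite [X in _ --> X](_ : _ = \sum_(i in I) (0 : R) ^+ 2); last first.
      by rewrite big1 // => i _; rewrite expr0n.
    apply: cvg_big => [|i _]; first exact: add_continuous.
    by apply: cvgM; exact: (hl i).
  move=> /cvgrPdist_lt/(_ e e0)[N _ hN]; exists N => k Nk.
  have := hN k Nk; rewrite /= sub0r normrN ger0_norm.
    by rewrite /amp_rip; under eq_bigr do rewrite -ripE.
  by apply: sumr_ge0 => i _; rewrite sqr_ge0.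
- exact: Y0.
- exact: Ylin.
by exists w.
Qed.

Lemma amp_closure_self (Y : set (I -> V)) : Y `<=` amp_closure Y.
Proof.
move=> y Yy e e0; exists y => //; rewrite subrr.
by rewrite /amp_rip big1 // => i _; rewrite rip0l.
Qed.

Lemma amp_closure_orth (Y : set (I -> V)) d w : amp_closure Y w ->
  (forall y, Y y -> amp_rip d y = 0) -> amp_rip d w = 0.
Proof.
move=> Yw dY; apply/eqP; rewrite -sqrf_eq0 eq_le sqr_ge0 andbT.
apply/ler_addgt0Pr => e e0; rewrite add0r.
have d1 : 0 < amp_rip d d + 1 by rewrite ltr_wpDl // amp_rip_ge0.
have [y Yy hy] := Yw _ (divr_gt0 e0 d1).
have -> : amp_rip d w = - amp_rip d (y - w).
  by rewrite !(amp_ripC d) amp_ripB (amp_ripC y) dY // sub0r opprK.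
rewrite sqrrN; apply: (le_trans (form_CS amp_ripC amp_ripD amp_ripZ amp_rip_ge0 _ _)).
move: hy; rewrite ltr_pdivlMr // mulrDr mulr1 mulrC => hy.
by have := amp_rip_ge0 (y - w); lra.
Qed.

Lemma amp_closureD (Y : set (I -> V)) v w : (forall a b, Y a -> Y b -> Y (a + b)) ->
  amp_closure Y v -> amp_closure Y w -> amp_closure Y (v + w).
Proof.
move=> YD hv hw e e0.
have e4 : 0 < e / 4 by lra.
have [a Ya ha] := hv _ e4; have [b Yb hb] := hw _ e4.
exists (a + b); first exact: YD.
have := form_parallelogram amp_ripC amp_ripD amp_ripZ (a - v) (b - w).
have := amp_rip_ge0 (a - v - (b - w)).
rewrite (_ : a + b - (v + w) = a - v + (b - w)); last by rewrite opprD addrACA.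
by lra.
Qed.

Lemma amp_closure_map (Y : set (I -> V)) (g : (I -> V) -> I -> V) (C : R) v :
  (forall a b, g (a - b) = g a - g b) -> (forall a, Y a -> Y (g a)) ->
  (forall a, amp_rip (g a) (g a) <= C * amp_rip a a) ->
  amp_closure Y v -> amp_closure Y (g v).
Proof.
move=> gB gY gC hv e e0.
have C1 : 0 < `|C| + 1 by rewrite ltr_wpDl.
have [a Ya ha] := hv _ (divr_gt0 e0 C1).
exists (g a); first exact: gY.
rewrite -gB; apply: (le_lt_trans (gC _)); move: ha; rewrite ltr_pdivlMr //; apply: le_lt_trans.
rewrite mulrC ler_wpM2l ?amp_rip_ge0 //.
by apply: (le_trans (ler_norm _)); rewrite lerDl.
Qed.

Lemma amp_op_bound (T : V -> V) (C : R) v : (forall x, hnorm (T x) <= C * hnorm x) ->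
  amp_rip (T \o v) (T \o v) <= C ^+ 2 * amp_rip v v.
Proof.
move=> hC; rewrite /amp_rip mulr_sumr; apply: ler_sum => i _; rewrite !ripE -exprMn.
have h0 : 0 <= C * hnorm (v i) by exact: le_trans (hnorm_ge0 _) (hC _).
by rewrite ler_pXn2r ?nnegrE ?hnorm_ge0 //; exact: hC.
Qed.

Context (M : set (V -> V)).
Hypothesis hM : sot_star_algebra M.
Hypothesis irrM : forall Y : set V, closed_subspace Y ->
  (forall T x, M T -> Y x -> Y (T x)) -> Y = [set 0] \/ Y = setT.

(* The projection onto the closure of [M a] in [V ^ I] commutes with the
   amplification of [M], so by Schur its matrix entries are scalars; hence it
   commutes with every amplified operator. *)
Lemma irreducible_functional (a b : I -> V) (S : V -> V) :
  (forall T, M T -> \sum_i rip (T (a i)) (b i) = 0) -> bounded_op S ->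
  \sum_i rip (S (a i)) (b i) = 0.
Proof.
move=> hab bS; have lS := bounded_op_lin bS.
pose Y : set (I -> V) := [set T \o a | T in M].
have Y0 : Y 0 by exists (fun=> 0); [exact: (sot_zero hM)|].
have YD v w : Y v -> Y w -> Y (v + w).
  move=> [S1 M1 <-] [S2 M2 <-]; exists (fun x => S1 x + S2 x) => //.
  exact: (sot_add hM).
have YM T v : M T -> Y v -> Y (T \o v).
  by move=> MT [S1 M1 <-]; exists (T \o S1) => //; exact: (sot_comp hM).
have YZ c v : Y v -> Y (c *: v).
  by move=> Yv; apply: (YM (fun x => c *: x)) => //; exact: (sot_scale hM c (sot_id hM)).
have Ylin (r : R) v w : Y v -> Y w -> Y (v + r%:C *: w) by move=> Yv Yw; exact/YD/YZ.
have clM T v : M T -> amp_closure Y v -> amp_closure Y (T \o v).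
  move=> MT; have /bounded_opP[lT [C C0 hC]] := sot_bounded hM MT.
  apply: (@amp_closure_map Y (fun v => T \o v) (C ^+ 2)) => [u w|u Yu|u].
  - by apply/funext => i /=; rewrite (linearB_of lT).
  - exact: YM.
  - exact: amp_op_bound.
have clZ c v : amp_closure Y v -> amp_closure Y (c *: v).
  by move=> Yv; apply: (clM (fun x => c *: x)) => //; exact: (sot_scale hM c (sot_id hM)).
have clD v w := amp_closureD (v := v) (w := w) YD.
have ex v : exists w, amp_closure Y w /\ forall y, Y y -> amp_rip (v - w) y = 0.
  by have [w h1 h2] := amp_projection v Y0 Ylin; exists w.
have [P hP] := choice ex.
(* [P] comes from a choice; this uniqueness makes it linear and commuting with the amplification of
   [M]. *)
have Puniq v w : amp_closure Y w -> (forall y, Y y -> amp_rip (v - w) y = 0) -> P v = w.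
  move=> Yw ow; apply/eqP; rewrite -subr_eq0; apply/eqP/amp_rip_eq0.
  have cd : amp_closure Y (P v - w).
    by rewrite -scaleN1r; apply: clD; [exact: (hP v).1|exact: clZ].
  apply: (amp_closure_orth cd) => y Yy.
  have -> : P v - w = (v - w) - (v - P v) by rewrite opprB [RHS]addrC addrA subrK.
  by rewrite amp_ripB ow // (hP v).2 // subrr.
have PM T v : M T -> P (T \o v) = T \o P v.
  move=> MT; have bT := sot_bounded hM MT; have lT := bounded_op_lin bT.
  apply: Puniq; first by apply: clM => //; exact: (hP v).1.
  have [T' bT' TT'] := bounded_op_adjoint bT; have MT' := sot_adj hM MT bT' TT'.
  move=> y Yy; rewrite -((hP v).2 (T' \o y)); last exact: YM.
  apply: eq_bigr => i _; rewrite [RHS]/= -TT'; congr (rip _ _).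
  exact/esym/(linearB_of lT).
have PD v w : P (v + w) = P v + P w.
  apply: Puniq; first by apply: clD; [exact: (hP v).1|exact: (hP w).1].
  by move=> y Yy; rewrite opprD addrACA amp_ripD (hP v).2 // (hP w).2 // addr0.
have PZ c v : P (c *: v) = c *: P v.
  exact: (PM (fun x => c *: x) v (sot_scale hM c (sot_id hM))).
have Pbd v : amp_rip (P v) (P v) <= amp_rip v v.
  have o : amp_rip (v - P v) (P v) = 0 by apply: amp_closure_orth (hP v).1 (hP v).2.
  have := amp_rip_ge0 (v - P v).
  have := form_expand amp_ripC amp_ripD amp_ripZ (v - P v) (P v) 1.
  rewrite scale1r subrK o; lra.
pose at_ (j : I) (x : V) : I -> V := fun i => if i == j then x else 0.
have at_lin j : linear (at_ j).
  move=> c x y; apply/funext => i; rewrite /at_ /GRing.add /GRing.scale /=.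
  by case: ifP => // _; rewrite scaler0 addr0.
have at_rip j x : amp_rip (at_ j x) (at_ j x) = hnorm x ^+ 2.
  rewrite /amp_rip (bigD1 j) //= big1 ?addr0; last first.
    by move=> i /negPf ij; rewrite /at_ ij rip0l.
  by rewrite /at_ eqxx ripE.
have at_sum v : v = \sum_j at_ j (v j).
  apply/funext => i; rewrite fct_sumE (bigD1 i) //= big1 ?addr0; last first.
    by move=> j; rewrite eq_sym => /negPf ij; rewrite /at_ ij.
  by rewrite /at_ eqxx.
have entry i j : exists c : R[i], forall x, P (at_ j x) i = c *: x.
  apply: (schur hM irrM).
    apply/bounded_opP; split; first by move=> c x y; rewrite at_lin PD PZ.
    exists 1 => // x; rewrite mul1r -(@ler_pXn2r _ 2) ?nnegrE ?hnorm_ge0 //.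
    rewrite -(at_rip j x); exact: le_trans (amp_rip_comp (P (at_ j x)) i) (Pbd _).
  move=> T MT x; have lT := bounded_op_lin (sot_bounded hM MT).
  have -> : at_ j (T x) = T \o at_ j x.
    by apply/funext => k; rewrite /= /at_; case: ifP => // _; rewrite (linear0_of lT).
  by rewrite PM.
have [q hq] := choice (fun ij : I * I => entry ij.1 ij.2).
have PE v i : P v i = \sum_j q (i, j) *: v j.
  rewrite {1}(at_sum v) (big_morph P PD (id1 := 0)); last by have := PZ 0 0; rewrite !scale0r.
  by rewrite fct_sumE; apply: eq_bigr => j _; rewrite (hq (i, j)).
(* [P] fixes [a] and has scalar entries, so it fixes [S \o a], which therefore lies in the closure
   of [Y], where [b] is orthogonal to everything. *)
have Ya : Y a by exists id => //; exact: (sot_id hM).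
have Pa : P a = a.
  apply: Puniq; first exact: amp_closure_self.
  by move=> y _; rewrite subrr /amp_rip big1 // => i _; rewrite rip0l.
have PSa : P (S \o a) = S \o a.
  apply/funext => i /=; rewrite PE -{2}Pa PE (linear_sum_of lS).
  by apply: eq_bigr => j _; rewrite (linearZ_of lS).
have clSa : amp_closure Y (S \o a) by rewrite -PSa; exact: (hP _).1.
rewrite -[LHS]/(amp_rip (S \o a) b) amp_ripC; apply: (amp_closure_orth clSa).
by move=> _ [T MT <-]; rewrite amp_ripC; exact: hab.
Qed.

End Amplification.

Section Irreducible.
Context (R : realType) (V : hilbertType R).

(** [T x] and ['i *: x] are orthogonal for [rip], because [inner (T x) x] is real. *)
Lemma hnorm_resolvent (T : V -> V) x : bounded_op T ->
  (forall x y, rip (T x) y = rip x (T y)) ->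
  hnorm (T x - 'i *: x) ^+ 2 = hnorm (T x) ^+ 2 + hnorm x ^+ 2.
Proof.
move=> bT sT; have lT := bounded_op_lin bT.
have o : rip (T x) ('i *: x) = 0.
  have h : rip (T x) ('i *: x) = - rip (T x) ('i *: x).
    rewrite {1}sT (linearZ_of lT) rip_conjr.
    by rewrite scale_conji ripNl ripC.
  lra.
by rewrite -ripE ripBl !ripBr (ripC _ (T x)) o !ripE hnormZi; ring.
Qed.

(** The formula is (T - i)^-1 = (T^2 + 1)^-1 (T + i), where [P], that is T^2 + 1, is bounded below
    by 1 and hence inverted inside [N]. The bound follows from [hnorm_resolvent]. *)
Lemma resolvent (N : set (V -> V)) (T : V -> V) : sot_star_algebra N -> N T ->
  (forall x y, rip (T x) y = rip x (T y)) ->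
  exists G, [/\ N G, forall x, G (T x - 'i *: x) = x,
    forall x, T (G x) - 'i *: G x = x & forall x, hnorm (G x) <= hnorm x].
Proof.
move=> hN NT sT; have bT := sot_bounded hN NT.
have /bounded_opP[lT [C C0 hC]] := bT.
pose P := fun x => T (T x) + x.
have NP : N P := sot_add hN (sot_comp hN NT NT) (sot_id hN).
have PE x : rip (P x) x = hnorm (T x) ^+ 2 + hnorm x ^+ 2 by rewrite ripDl sT !ripE.
have [|||x|Q [NQ PQ QP]] := sot_inverse hN (c := 1) (C := C ^+ 2 + 1) NP.
- by move=> x y; rewrite ripDl ripDr !sT.
- by [].
- by move=> x; rewrite PE mul1r lerDr sqr_ge0.
- rewrite PE mulrDl mul1r lerD2r -exprMn ler_pXn2r ?nnegrE ?hnorm_ge0 //.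
  by rewrite mulr_ge0 ?hnorm_ge0.
have lQ := bounded_op_lin (sot_bounded hN NQ).
pose Tp := fun x => T x + 'i *: x.
have NTp : N Tp by exact: (sot_add hN NT (sot_scale hN _ (sot_id hN))).
have ii (x : V) : 'i *: ('i *: x) = - x by rewrite scalerA -expr2 sqr_i scaleN1r.
have TpTm x : Tp (T x - 'i *: x) = P x.
  rewrite /Tp /P (linearB_of lT) (linearZ_of lT) scalerBr ii opprK addrA.
  by rewrite subrK.
have TmTp x : T (Tp x) - 'i *: Tp x = P x.
  rewrite /Tp /P (linearD_of lT) (linearZ_of lT) scalerDr ii opprD opprK addrA.
  by rewrite addrK.
pose G := Q \o Tp.
have G1 x : G (T x - 'i *: x) = x by rewrite /G /= TpTm QP.
(* Writing [x = P (Q x)] as T - i applied to [Tp (Q x)] reduces this to [G1], with no need to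
   commute [Q] past [T]. *)
have G2 x : T (G x) - 'i *: G x = x.
  by rewrite -{1 2}(PQ x) -{1 2}TmTp !G1 TmTp PQ.
exists G; split=> //; first exact: (sot_comp hN NQ NTp).
move=> x; rewrite -(@ler_pXn2r _ 2) ?nnegrE ?hnorm_ge0 //.
by rewrite -{2}(G2 x) hnorm_resolvent // lerDr sqr_ge0.
Qed.

Context (M : set (V -> V)).
Hypothesis hM : sot_star_algebra M.
Hypothesis irrM : forall Y : set V, closed_subspace Y ->
  (forall T x, M T -> Y x -> Y (T x)) -> Y = [set 0] \/ Y = setT.

(** Taking real parts of arbitrary approximants would fail, the adjoint not being strongly
    continuous. Instead [S \o x] is projected onto the closure of the real subspace generated by
    selfadjoint elements of [M], and the residue [u] is shown to vanish. *)
Lemma irreducible_selfadjoint_approx (I : finType) (S : V -> V) (x : I -> V) (e : R) :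
  bounded_op S -> (forall x y, rip (S x) y = rip x (S y)) -> 0 < e ->
  exists T, [/\ M T, forall x y, rip (T x) y = rip x (T y) &
    amp_rip ((T \o x) - (S \o x)) ((T \o x) - (S \o x)) < e].
Proof.
move=> bS sS e0.
pose Y : set (I -> V) :=
  [set T \o x | T in [set T | M T /\ forall x y, rip (T x) y = rip x (T y)]].
have [||w wY ow] := @amp_projection R V I Y (S \o x).
- exists (fun=> 0) => //; split; first exact: sot_zero.
  by move=> a b; rewrite rip0l rip0r.
- move=> r _ _ [T1 [M1 s1] <-] [T2 [M2 s2] <-].
  exists (fun v => T1 v + r%:C *: T2 v) => //; split.
    exact: (sot_add hM M1 (sot_scale hM _ M2)).
  by move=> a b; rewrite ripDl ripDr ripZl ripZr s1 s2.
set u := (S \o x) - w.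
have oS : amp_rip u (S \o x) = 0.
  (* Doubling the index set symmetrizes the functional: on [T] in [M] it equals the pairing of
     [(T + T') \o x] with [u], which is zero as [T + T'] is selfadjoint; on [S] it is twice the
     wanted pairing. *)
  pose a (i : I + I) := match i with inl j => x j | inr j => u j end.
  pose b (i : I + I) := match i with inl j => u j | inr j => x j end.
  have := @irreducible_functional R V (I + I)%type M hM irrM a b S _ bS.
  rewrite big_sumType /= => h.
  have {}h : \sum_i rip (S (x i)) (u i) + \sum_i rip (S (u i)) (x i) = 0.
    apply: h => T MT; rewrite big_sumType /=.
    have [T' bT' TT'] := bounded_op_adjoint (sot_bounded hM MT).
    have MT' := sot_adj hM MT bT' TT'.
    transitivity (amp_rip ((fun v => T v + T' v) \o x) u).
      rewrite /amp_rip -big_split; apply: eq_bigr => i _ /=.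
      by rewrite ripDl (ripC (T' _)) -TT'.
    rewrite amp_ripC; apply: ow.
    exists (fun v => T v + T' v) => //; split; first exact: (sot_add hM).
    by move=> p q; rewrite ripDl ripDr (ripC (T' p)) -!TT' (ripC p (T q)) addrC.
  have e1 : \sum_i rip (S (u i)) (x i) = \sum_i rip (S (x i)) (u i).
    by apply: eq_bigr => i _; rewrite sS ripC.
  rewrite e1 in h; rewrite amp_ripC; rewrite /amp_rip /=; lra.
have ouw : amp_rip u w = 0 by apply: (amp_closure_orth wY).
have u0 : u = 0.
  by apply: amp_rip_eq0; rewrite {2}/u amp_ripC amp_ripB !(amp_ripC _ u) oS ouw subrr.
have wE : w = S \o x by apply/esym/eqP; rewrite -subr_eq0; apply/eqP.
have [_ [T [MT sT] <-] hT] := wY e e0.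
by exists T; split=> //; rewrite -wE.
Qed.

Context (e : nat -> V).
Hypothesis e_total : dense [set v | exists n (c : nat -> R[i]), v = \sum_(k < n) c k *: e k].

(* Approximants of [S] on [e] need not be bounded, but their resolvents are
   contractions and converge strongly to the resolvent of [S]. *)
Lemma irreducible_selfadjoint (S : V -> V) : bounded_op S ->
  (forall x y, rip (S x) y = rip x (S y)) -> M S.
Proof.
move=> bS sS; have /bounded_opP[lS [C C0 hC]] := bS.
have ex (n : nat) : exists T, [/\ M T, forall x y, rip (T x) y = rip x (T y) &
    forall k, (k <= n)%N -> hnorm (T (e k) - S (e k)) < n.+1%:R^-1].
  have n0 : 0 < n.+1%:R^-1 :> R by rewrite invr_gt0.
  have [T [MT sT hT]] := @irreducible_selfadjoint_approx 'I_n.+1 S (fun i => e i)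
    _ bS sS (exprn_gt0 2 n0).
  exists T; split=> // k kn; rewrite -(@ltr_pXn2r _ 2) ?nnegrE ?hnorm_ge0 //.
  apply: (le_lt_trans _ hT).
  exact: (amp_rip_comp ((T \o (fun i : 'I_n.+1 => e i)) - (S \o (fun i : 'I_n.+1 => e i)))
    (Ordinal (kn : (k < n.+1)%N))).
have [T hT] := choice ex.
have lT n : linear (T n) by have [MT _ _] := hT n; exact/bounded_op_lin/(sot_bounded hM).
have cT k : hcvg (fun n => T n (e k)) (S (e k)).
  apply/hcvgP => d d0.
  have [N _ hN] := near_infty_natSinv_lt (PosNum d0).
  exists (maxn N k) => i; rewrite geq_max => /andP[Ni ki].
  by have [_ _ h] := hT i; apply: (lt_trans (h k ki)); exact: (hN i Ni).
have exG n := resolvent hM (let: And3 m _ _ := hT n in m) (let: And3 _ s _ := hT n in s).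
have [G hG] := choice exG.
have bdd := sot_star_algebra_bounded_op V.
have [Rs [bR R1 R2 Rb]] := resolvent bdd bS sS.
have cspan n (c : nat -> R[i]) : hcvg (fun m => T m (\sum_(k < n) c k *: e k))
    (S (\sum_(k < n) c k *: e k)).
  elim: n => [|n IH].
    rewrite big_ord0 (linear0_of lS); under eq_fun do rewrite (linear0_of (lT _)).
    exact: hcvg_cst.
  rewrite big_ord_recr /= (linearD_of lS) (linearZ_of lS).
  under eq_fun do rewrite (linearD_of (lT _)) (linearZ_of (lT _)).
  by apply: hcvgD => //; exact: hcvgZ.
have lG n : linear (G n) by have [MG _ _ _] := hG n; exact/bounded_op_lin/(sot_bounded hM).
have cG x : hcvg (fun n => G n x) (Rs x).
  apply/hcvgP => d d0.
  (* The budget is [C + 1] for S - i applied to [Rs x - y'], 1 for [S y' - T i y'], and 1 for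
     [y' - Rs x]. *)
  have C2 : 0 < C + 3 by rewrite ltr_wpDl.
  have [y' [n [c y'E]] hy'] := dense_hnorm (Rs x) e_total (divr_gt0 d0 C2).
  have d3 : 0 < d / (C + 3) by rewrite divr_gt0.
  have /hcvgP/(_ _ d3)[N hN] := cspan n c; exists N => i Ni.
  have := hN i Ni; rewrite -y'E => h1.
  have [_ g1 g2 gb] := hG i.
  have -> : G i x - Rs x = G i (S (Rs x - y') - 'i *: (Rs x - y')) +
      (G i (S y' - T i y') + (y' - Rs x)).
    have -> : G i x = G i (S (Rs x - y') - 'i *: (Rs x - y') + (S y' - T i y') +
        (T i y' - 'i *: y')).
      congr (G i _); rewrite -[LHS](R2 x) (linearB_of lS) scalerBr -[RHS]addrA.
      rewrite (addrA (S y' - _)) subrK addrACA subrK opprB.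
      by rewrite (addrAC ('i *: y')) subrr add0r.
    by rewrite (linearD_of (lG i)) g1 (linearD_of (lG i)) -!addrA.
  have hb1 := gb (S (Rs x - y') - 'i *: (Rs x - y')).
  have hb2 := gb (S y' - T i y').
  have hb3 := ler_hnormD (S (Rs x - y')) (- ('i *: (Rs x - y'))).
  have hb4 := hC (Rs x - y').
  have hb5 := ler_hnormD (G i (S (Rs x - y') - 'i *: (Rs x - y')))
    (G i (S y' - T i y') + (y' - Rs x)).
  have hb6 := ler_hnormD (G i (S y' - T i y')) (y' - Rs x).
  rewrite hnormC in h1; rewrite hnorm_opp hnormZi in hb3.
  rewrite (hnormC (Rs x) y') in hb3 hb4.
  set D := d / (C + 3) in h1 hy' d3.
  have DE : d = C * D + 3 * D by rewrite /D; field; rewrite gt_eqF.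
  have hb7 : C * hnorm (y' - Rs x) <= C * D by rewrite ler_wpM2l // ltW.
  rewrite DE; lra.
have MR : M Rs.
  have lR := bounded_op_lin bR.
  apply: (@sot_lim _ _ _ hM G Rs 1) => //.
  - by move=> n; have [] := hG n.
  - by move=> n x; rewrite mul1r; have [_ _ _] := hG n; apply.
have [E bE RE] := bounded_op_adjoint bR.
have ME := sot_adj hM MR bE RE.
have lE := bounded_op_lin bE.
have C1 : 0 < C + 1 by rewrite ltr_wpDl.
have RRE x : rip ((E \o Rs) x) x = hnorm (Rs x) ^+ 2 by rewrite /= ripC -RE ripE.
(* From [x = S (Rs x) - 'i *: Rs x] one gets [hnorm x <= (C + 1) * hnorm (Rs x)], whence the lower
   bound on [E \o Rs]. Its inverse [Q] makes [Q \o E] an inverse of [Rs] in [M], namely S - i. *)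
have [||||x|Q [MQ Q1 Q2]] := @sot_inverse _ _ _ hM (E \o Rs) ((C + 1) ^- 2) 1.
- exact: (sot_comp hM).
- by move=> x y; rewrite /= ripC -!RE ripC.
- by rewrite invr_gt0 exprn_gt0.
- move=> x; rewrite RRE mulrC ler_pdivrMr ?exprn_gt0 // -exprMn.
  rewrite ler_pXn2r ?nnegrE ?mulr_ge0 ?hnorm_ge0 ?(ltW C1) //.
  rewrite -{1}(R2 x); have := ler_hnormD (S (Rs x)) (- ('i *: Rs x)).
  rewrite hnorm_opp hnormZi => h; apply: (le_trans h).
  by rewrite mulrDr mulr1 lerD2r mulrC.
- rewrite RRE mul1r ler_pXn2r ?nnegrE ?hnorm_ge0 //.
have -> : S = fun x => (Q \o E) x + 'i *: x.
  apply/funext => x; have := Q2 (S x - 'i *: x); rewrite /= R1 => ->.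
  by rewrite subrK.
exact: (sot_add hM (sot_comp hM MQ ME) (sot_scale hM _ (sot_id hM))).
Qed.

Theorem irreducible_full (S : V -> V) : bounded_op S -> M S.
Proof.
move=> bS; have bdd := sot_star_algebra_bounded_op V.
have [E bE SE] := bounded_op_adjoint bS.
have lS := bounded_op_lin bS; have lE := bounded_op_lin bE.
have ES x y : rip (E x) y = rip x (S y) by rewrite ripC -SE ripC.
have M1 : M (fun x => S x + E x).
  apply: irreducible_selfadjoint; first exact: (sot_add bdd).
  by move=> x y; rewrite ripDl ripDr SE ES addrC.
have M2 : M (fun x => 'i *: (S x - E x)).
  apply: irreducible_selfadjoint.
    by apply: (sot_scale bdd); exact: (sot_sub bdd).
  move=> x y; rewrite rip_conj scale_conji.
  rewrite ripNr ripBl SE ES (linearZ_of lE) (linearZ_of lS) scalerBr ripBr; ring.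
have -> : S = fun x => (2^-1)%:C *: ((S x + E x) - 'i *: ('i *: (S x - E x))).
  apply/funext => x; rewrite scalerA -expr2 sqr_i scaleN1r opprK addrACA subrr addr0.
  rewrite -mulr2n -[S x *+ 2]scaler_nat scalerA.
  by rewrite -(rmorph_nat (real_complex R)) -rmorphM mulVf ?scale1r // pnatr_eq0.
exact: (sot_scale hM _ (sot_sub hM M1 (sot_scale hM _ M2))).
Qed.

End Irreducible.

(** * Direct integrals *)

Section Sections.
Context (R : realType) (d : measure_display) (X : measurableType d).
Context (K : hilbert_field R X).
Implicit Types s t : forall p, K p.

Lemma msectionZ (c : R[i]) s : msection s -> msection (fun p => c *: s p).
Proof.
move=> ms; have := msectionDZ c ms (msection0 K); congr msection.
by apply: functional_extensionality_dep => p; rewrite addr0.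
Qed.

Lemma msectionD s t : msection s -> msection t -> msection (fun p => s p + t p).
Proof.
move=> ms mt; have := msectionDZ 1 ms mt; congr msection.
by apply: functional_extensionality_dep => p; rewrite scale1r.
Qed.

Lemma msectionB s t : msection s -> msection t -> msection (fun p => s p - t p).
Proof.
move=> ms mt; have := msectionD ms (msectionZ (-1) mt); congr msection.
by apply: functional_extensionality_dep => p; rewrite scaleN1r.
Qed.

Lemma measurable_hnorm2 s : msection s -> measurable_fun setT (fun p => hnorm (s p) ^+ 2).
Proof. by move=> ms; apply: measurable_funX; exact: msection_norm. Qed.

Lemma measurable_rip s t : msection s -> msection t ->
  measurable_fun setT (fun p => rip (s p) (t p)).
Proof.
move=> ms mt.
have -> : (fun p => rip (s p) (t p)) =
    (fun p => 4^-1 * (hnorm (s p + t p) ^+ 2 - hnorm (s p - t p) ^+ 2)).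
  apply/funext => p; rewrite -!ripE !(ripDl, ripDr, ripBl, ripBr, ripNl, ripNr).
  by rewrite (ripC (t p)); field.
apply: measurable_funM; first exact: measurable_cst.
by apply: measurable_funB; apply: measurable_hnorm2; [exact: msectionD|exact: msectionB].
Qed.

(** The imaginary part of the pairing with [s] is, up to sign, the real part of the pairing with a
    scalar multiple of [s]. *)
Lemma msection_rip t :
  (forall s, msection s -> measurable_fun setT (fun p => rip (t p) (s p))) -> msection t.
Proof.
move=> h; apply: msection_complete => s ms; split; first exact: h.
have -> : (fun p => complex.Im (inner (t p) (s p))) =
    \- (fun p => rip (t p) (('i : R[i])^* *: s p)).
  by apply/funext => p; rewrite inner_ripE /= rip_conj.
by apply: measurable_funN; apply: h; exact: msectionZ.
Qed.

Lemma msection_scale (f : X -> R) s : measurable_fun setT f -> msection s ->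
  msection (fun p => (f p)%:C *: s p).
Proof.
move=> mf ms; apply: msection_rip => t mt.
under eq_fun do rewrite ripZl.
by apply: measurable_funM => //; exact: measurable_rip.
Qed.

Lemma msection_lim (u : nat -> forall p, K p) s : (forall n, msection (u n)) ->
  (forall p, hcvg (fun n => u n p) (s p)) -> msection s.
Proof.
move=> mu cu; apply: msection_rip => t mt.
apply: (measurable_fun_cvg (h := fun n p => rip (u n p) (t p))).
  by move=> n; exact: measurable_rip.
by move=> p _; exact: hcvg_rip.
Qed.

End Sections.

Section DirectIntegral.
Context (R : realType) (d : measure_display) (X : measurableType d).
Context (mu : {finite_measure set X -> \bar R}) (K : hilbert_field R X).
Context (H : hilbertType R) (W : H -> forall p, K p).
Hypothesis hW : unitary_onto_direct_integral mu W.
Implicit Types (x y : H) (F G : forall p, K p -> K p) (B : H -> H).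

Lemma W_msection x : msection (W x). Proof. by case: hW. Qed.

Lemma W_lin c x y : {ae mu, forall p, W (c *: x + y) p = c *: W x p + W y p}.
Proof. by case: hW. Qed.

Lemma W_norm x : (\int[mu]_p (hnorm (W x p) ^+ 2)%:E)%E = (hnorm x ^+ 2)%:E.
Proof. by case: hW. Qed.

Lemma W_D x y : {ae mu, forall p, W (x + y) p = W x p + W y p}.
Proof.
by have := W_lin 1 x y; apply: filterS => p; rewrite !scale1r.
Qed.

Lemma W_0 : {ae mu, forall p, W 0 p = 0}.
Proof.
have := W_lin (-1) 0 0; apply: filterS => p; rewrite !scaleN1r addr0 oppr0 => ->.
by rewrite addNr.
Qed.

Lemma W_Z c x : {ae mu, forall p, W (c *: x) p = c *: W x p}.
Proof.
have := W_lin c x 0; have := W_0; apply: filterS2 => p h0.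
by rewrite h0 !addr0.
Qed.

Lemma W_B x y : {ae mu, forall p, W (x - y) p = W x p - W y p}.
Proof.
have := W_lin (-1) y x; apply: filterS => p.
by rewrite !scaleN1r addrC => ->; rewrite addrC.
Qed.

Lemma W_sum (I : Type) (s : seq I) (f : I -> H) :
  {ae mu, forall p, W (\sum_(k <- s) f k) p = \sum_(k <- s) W (f k) p}.
Proof.
elim: s => [|i s IH].
  by have := W_0; apply: filterS => p; rewrite !big_nil.
have := W_D (f i) (\sum_(k <- s) f k); have := IH; apply: filterS2 => p h.
by rewrite !big_cons /= => ->; rewrite h.
Qed.

Let measurable_Wn2 x : measurable_fun setT (fun p => (hnorm (W x p) ^+ 2)%:E).
Proof. by apply/measurable_EFinP; apply: measurable_hnorm2; exact: W_msection. Qed.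

(* Polarization reduces the positivity of an inner product to an inequality
   between integrals of nonnegative functions. *)
Lemma rip_sum_ge0 (I : finType) (x y : I -> H) :
  {ae mu, forall p, 0 <= \sum_i rip (W (y i) p) (W (x i) p)} ->
  0 <= \sum_i rip (y i) (x i).
Proof.
move=> h.
have key : \sum_i hnorm (x i - y i) ^+ 2 <= \sum_i hnorm (x i + y i) ^+ 2.
  rewrite -lee_fin -!sumEFin.
  rewrite -(eq_bigr _ (fun i _ => W_norm (x i - y i))).
  rewrite -(eq_bigr _ (fun i _ => W_norm (x i + y i))).
  rewrite -!ge0_integral_sum //; try by move=> n p _; rewrite lee_fin sqr_ge0.
  apply: ae_ge0_le_integral => //.
  - by move=> p _; apply: sume_ge0 => i _; rewrite lee_fin sqr_ge0.
  - by apply: emeasurable_sum => i; exact: measurable_Wn2.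
  - by move=> p _; apply: sume_ge0 => i _; rewrite lee_fin sqr_ge0.
  - by apply: emeasurable_sum => i; exact: measurable_Wn2.
  have hD : {ae mu, forall p, forall i, W (x i + y i) p = W (x i) p + W (y i) p}.
    by apply: filter_forall => i; exact: W_D.
  have hB : {ae mu, forall p, forall i, W (x i - y i) p = W (x i) p - W (y i) p}.
    by apply: filter_forall => i; exact: W_B.
  near=> p => _.
  rewrite !sumEFin lee_fin -subr_ge0 -sumrB.
  rewrite (eq_bigr (fun i => 4 * rip (W (y i) p) (W (x i) p))).
    by rewrite -mulr_sumr mulr_ge0 //; near: p.
  move=> i _; have -> : W (x i + y i) p = W (x i) p + W (y i) p by move: i; near: p.
  have -> : W (x i - y i) p = W (x i) p - W (y i) p by move: i; near: p.
  rewrite -!ripE !(ripDl, ripDr, ripBl, ripBr, ripNl, ripNr).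
  by rewrite (ripC (W (x i) p)); ring.
have : 0 <= \sum_i (hnorm (x i + y i) ^+ 2 - hnorm (x i - y i) ^+ 2).
  by rewrite sumrB subr_ge0.
rewrite (eq_bigr (fun i => 4 * rip (y i) (x i))); last first.
  move=> i _; rewrite -!ripE !(ripDl, ripDr, ripBl, ripBr, ripNl, ripNr).
  by rewrite (ripC (x i)); ring.
by rewrite -mulr_sumr pmulr_rge0.
Unshelve. all: by end_near. Qed.

(** Nonnegativity in [R[i]] includes being real, so besides the real part the imaginary part must
    vanish; this is obtained as two opposite inequalities from [rip_sum_ge0]. *)
Lemma inner_sum_ge0 (I : finType) (x y : I -> H) :
  {ae mu, forall p, 0 <= \sum_i inner (W (y i) p) (W (x i) p)} ->
  0 <= \sum_i inner (y i) (x i).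
Proof.
move=> h.
have Re_sum (V : hilbertType R) (a b : I -> V) :
    complex.Re (\sum_i inner (a i) (b i)) = \sum_i rip (a i) (b i).
  by rewrite raddf_sum.
have Im_sum (V : hilbertType R) (a b : I -> V) :
    complex.Im (\sum_i inner (a i) (b i)) = - \sum_i rip ('i *: a i) (b i).
  by rewrite raddf_sum -sumrN; apply: eq_bigr => i _; rewrite inner_ripE.
have hr : {ae mu, forall p, 0 <= \sum_i rip (W (y i) p) (W (x i) p)}.
  by apply: filterS h => p; rewrite lecE Re_sum => /andP[].
have hi : {ae mu, forall p, \sum_i rip ('i *: W (y i) p) (W (x i) p) = 0}.
  by apply: filterS h => p; rewrite lecE Im_sum oppr_eq0 => /andP[/eqP].
have hZ : {ae mu, forall p, forall i, W ('i *: y i) p = 'i *: W (y i) p}.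
  by apply: filter_forall => i; exact: W_Z.
have hN : {ae mu, forall p, forall i, W (- ('i *: y i)) p = - W ('i *: y i) p}.
  apply: filter_forall => i; have := W_Z (-1) ('i *: y i); apply: filterS => p.
  by rewrite !scaleN1r.
rewrite lecE Re_sum Im_sum rip_sum_ge0 // andbT oppr_eq0 eq_le; apply/andP; split.
  rewrite -oppr_ge0 -sumrN.
  under eq_bigr do rewrite -ripNl.
  apply: rip_sum_ge0; apply: filterS3 hi hZ hN => p e1 e2 e3.
  under eq_bigr do rewrite e3 e2 ripNl.
  by rewrite sumrN e1 oppr0.
apply: rip_sum_ge0; apply: filterS2 hi hZ => p e1 e2.
by under eq_bigr do rewrite e2; rewrite e1.
Qed.

(** Families indexed by [bool] present a difference of inner products as a sum, to which
    [rip_sum_ge0] applies in both directions. *)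
Lemma rip_ae_eq x y x' y' :
  {ae mu, forall p, rip (W x p) (W y p) = rip (W x' p) (W y' p)} ->
  rip x y = rip x' y'.
Proof.
have le a b a' b' : {ae mu, forall p, rip (W a p) (W b p) = rip (W a' p) (W b' p)} ->
    rip a b <= rip a' b'.
  move=> h; rewrite -subr_ge0 -ripNl.
  have := @rip_sum_ge0 bool (fun i => if i then b' else b) (fun i => if i then a' else - a).
  rewrite !big_bool; apply.
  have := W_Z (-1) a; apply: filterS2 h => p e1.
  by rewrite !scaleN1r big_bool /= => ->; rewrite ripNl e1 subrr.
move=> h; apply/eqP; rewrite eq_le !le //.
by apply: filterS h.
Qed.

Lemma hnorm_ae_le (C : R) x y : 0 <= C ->
  {ae mu, forall p, hnorm (W y p) <= C * hnorm (W x p)} -> hnorm y <= C * hnorm x.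
Proof.
move=> C0 h; rewrite -(@ler_pXn2r _ 2) ?nnegrE ?mulr_ge0 ?hnorm_ge0 //.
rewrite exprMn -subr_ge0 -!ripE -ripZl -ripNl.
have := @rip_sum_ge0 bool (fun i => if i then x else y)
  (fun i => if i then (C ^+ 2)%:C *: x else - y).
rewrite !big_bool; apply.
have := W_Z (-1) y; have := W_Z (C ^+ 2)%:C x; apply: filterS3 h => p e1 e2.
rewrite !scaleN1r big_bool /= => ->; rewrite e2 ripNl ripZl !ripE subr_ge0 -exprMn.
by rewrite ler_pXn2r ?nnegrE ?mulr_ge0 ?hnorm_ge0.
Qed.

Lemma W_inj x y : {ae mu, forall p, W x p = W y p} -> x = y.
Proof.
move=> h; apply/eqP; rewrite -subr_eq0; apply/eqP/hnorm_eq0/eqP.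
rewrite eq_le hnorm_ge0 andbT.
have := @hnorm_ae_le 0 0 (x - y) (lexx _); rewrite mul0r; apply.
have := W_B x y; apply: filterS2 h => p -> ->.
by rewrite subrr hnorm0 mul0r.
Qed.

(** The exceptional null set depends on [x]. The field determines the operator, by
    [implements_unique]. *)
Definition implements F B := forall x, {ae mu, forall p, W (B x) p = F p (W x p)}.

Lemma implements_unique F B B' : implements F B -> implements F B' -> B = B'.
Proof.
move=> h h'; apply/funext => x; apply: W_inj.
by have := h' x; apply: filterS2 (h x) => p -> ->.
Qed.

Lemma implements_bound F B (C : R) : 0 <= C -> implements F B ->
  (forall p v, hnorm (F p v) <= C * hnorm v) -> forall x, hnorm (B x) <= C * hnorm x.
Proof.
by move=> C0 h hC x; apply: hnorm_ae_le => //; apply: filterS (h x) => p ->.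
Qed.

Lemma field_op_exists F (C : R) : (forall p, linear (F p)) -> 0 <= C ->
  (forall p v, hnorm (F p v) <= C * hnorm v) ->
  (forall s, msection s -> msection (fun p => F p (s p))) ->
  exists2 B, bounded_op B & implements F B.
Proof.
move=> lF C0 hC mF.
have ex x : exists y, {ae mu, forall p, W y p = F p (W x p)}.
  case: hW => _ _ _ surj; apply: surj; first exact/mF/W_msection.
  apply: (@le_lt_trans _ _ (\int[mu]_p ((C ^+ 2)%:E * (hnorm (W x p) ^+ 2)%:E))%E).
    apply: ae_ge0_le_integral => //.
    - by move=> p _; rewrite lee_fin sqr_ge0.
    - by apply/measurable_EFinP/measurable_hnorm2/mF/W_msection.
    - by move=> p _; rewrite -EFinM lee_fin mulr_ge0 ?sqr_ge0.
    - by apply: measurable_funeM; exact: measurable_Wn2.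
    - apply: aeW => p _; rewrite -EFinM lee_fin -exprMn.
      by rewrite ler_pXn2r ?nnegrE ?mulr_ge0 ?hnorm_ge0.
  rewrite ge0_integralZl //.
  - by rewrite W_norm -EFinM ltry.
  - by move=> p _; rewrite lee_fin sqr_ge0.
  - by rewrite lee_fin sqr_ge0.
have [B hB] := choice ex.
exists B => //; apply/bounded_opP; split; last first.
  by exists C => //; exact: (implements_bound C0 hB hC).
move=> c x y; apply: W_inj.
have h1 := W_lin c x y; have h2 := W_lin c (B x) (B y).
have h3 := hB (c *: x + y); have h4 := hB x; have h5 := hB y.
near=> p.
have -> : W (B (c *: x + y)) p = F p (W (c *: x + y) p) by near: p.
have -> : W (c *: x + y) p = c *: W x p + W y p by near: p.
have -> : W (c *: B x + B y) p = c *: W (B x) p + W (B y) p by near: p.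
have -> : W (B x) p = F p (W x p) by near: p.
have -> : W (B y) p = F p (W y p) by near: p.
exact: lF.
Unshelve. all: by end_near. Qed.

Lemma implements_comp F G B B' : implements F B -> implements G B' ->
  implements (fun p => F p \o G p) (B \o B').
Proof.
by move=> h h' x; have := h' x; apply: filterS2 (h (B' x)) => p /= -> ->.
Qed.

Lemma implements_lcomb c F G B B' : implements F B -> implements G B' ->
  implements (fun p => (c \*: F p) \+ G p) ((c \*: B) \+ B').
Proof.
move=> h h' x; have := W_lin c (B x) (B' x); have := h' x.
by apply: filterS3 (h x) => p /= -> -> ->.
Qed.

Lemma implements_adj F G B B' : implements F B ->
  (forall p (v w : K p), rip (F p v) w = rip v (G p w)) ->
  (forall x y, rip (B x) y = rip x (B' y)) -> 
  (exists B'', implements G B'') -> implements G B'.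
Proof.
move=> h FG BB' [B'' h'']; suff -> : B' = B'' by [].
apply/funext => y; apply: rip_inj => z; rewrite ripC -BB' (ripC (B'' y)).
apply: rip_ae_eq; apply: filterS2 (h z) (h'' y) => p -> ->.
exact: FG.
Qed.

(* By dominated convergence. *)
Lemma implements_hcvg (Fn : nat -> forall p, K p -> K p) F (Bn : nat -> H -> H) B (C : R) :
  (forall n p v, hnorm (Fn n p v) <= C * hnorm v) ->
  (forall p v, hcvg (fun n => Fn n p v) (F p v)) ->
  (forall n, implements (Fn n) (Bn n)) -> implements F B ->
  forall x, hcvg (fun n => Bn n x) (B x).
Proof.
move=> hC cF hn hB x.
pose g n p := (hnorm (W (Bn n x - B x) p) ^+ 2)%:E.
have gE n : (\int[mu]_p g n p)%E = (hnorm (Bn n x - B x) ^+ 2)%:E by exact: W_norm.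
have hae : {ae mu, forall p, forall n, W (Bn n x - B x) p = Fn n p (W x p) - F p (W x p)}.
  apply: ae_foralln => n; have := W_B (Bn n x) (B x).
  by apply: filterS3 (hn n x) (hB x) => p -> ->.
have [|||||_ _ cint] := @dominated_convergence _ X R mu setT measurableT g (fun=> 0%E)
  (fun p => ((2 * C) ^+ 2)%:E * (hnorm (W x p) ^+ 2)%:E)%E.
- by move=> n; exact: measurable_Wn2.
- exact: measurable_cst.
- apply: filterS hae => p hp _; rewrite /g.
  under eq_fun do rewrite hp.
  apply/fine_cvgP; split; first by apply: nearW.
  rewrite [X in X @ _ --> _](_ : _ = fun n => hnorm (Fn n p (W x p) - F p (W x p)) ^+ 2) //.
  by rewrite -[0 in X in _ --> X](mulr0 (0 : R)); apply: cvgM; exact: cF.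
- apply: integrableZl => //; apply/integrableP; split; first exact: measurable_Wn2.
  under eq_integral do rewrite gee0_abs ?lee_fin ?sqr_ge0 //.
  by rewrite W_norm ltry.
- apply: filterS hae => p hp n _; rewrite /g hp gee0_abs ?lee_fin ?sqr_ge0 //.
  rewrite -exprMn.
  have Fb : hnorm (F p (W x p)) <= C * hnorm (W x p).
    exact: (hcvg_hnorm_le (fun n => hC n p (W x p)) (cF p (W x p))).
  have h1 := ler_hnormD (Fn n p (W x p)) (- F p (W x p)); rewrite hnorm_opp in h1.
  have h2 := hC n p (W x p).
  have h3 : hnorm (Fn n p (W x p) - F p (W x p)) <= 2 * C * hnorm (W x p) by lra.
  by rewrite ler_pXn2r ?nnegrE ?hnorm_ge0 // (le_trans (hnorm_ge0 _) h3).
rewrite integral0 in cint.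
have c2 : (fun n => hnorm (Bn n x - B x) ^+ 2) @ \oo --> (0 : R).
  apply: (@fine_cvg _ _ _ _ (fun n => (hnorm (Bn n x - B x) ^+ 2)%:E)).
  by under eq_fun do rewrite -gE.
apply/hcvgP => e e0; have /cvgrPdist_lt/(_ _ (exprn_gt0 2 e0))[N _ hN] := c2.
exists N => i Ni; have := hN i Ni; rewrite /= sub0r normrN ger0_norm ?sqr_ge0 //.
by rewrite ltr_pXn2r ?nnegrE ?hnorm_ge0 // ltW.
Qed.

(** Linearity and the bound hold at every point, so fields can be composed and passed to the limit
    pointwise; only the link with an operator of [N] is almost everywhere. *)
Definition good_field (N : set (H -> H)) F :=
  [/\ forall p, linear (F p),
      exists2 C : R, 0 <= C & forall p v, hnorm (F p v) <= C * hnorm v,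
      forall s, msection s -> msection (fun p => F p (s p))
    & exists2 B, N B & implements F B].

Section GoodFields.
Context (N : set (H -> H)) (hN : sot_star_algebra N).

Lemma good_lcomb c F G : good_field N F -> good_field N G ->
  good_field N (fun p => (c \*: F p) \+ G p).
Proof.
move=> [lF [C C0 hC] mF [B NB hB]] [lG [D D0 hD] mG [B' NB' hB']]; split.
- move=> p a v w /=; rewrite lF lG !scalerDr !scalerA (mulrC c a) addrACA //.
- exists (complex.Re `|c| * C + D); first by rewrite addr_ge0 // mulr_ge0 // Re_norm_ge0.
  move=> p v /=; apply: (le_trans (ler_hnormD _ _)); rewrite mulrDl lerD //.
  by rewrite hnormZ -mulrA ler_wpM2l // Re_norm_ge0.
- by move=> s ms; apply: msectionDZ; [exact: mF|exact: mG].
- by exists ((c \*: B) \+ B'); [exact: (sot_lcomb hN)|exact: implements_lcomb].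
Qed.

Lemma good_comp F G : good_field N F -> good_field N G ->
  good_field N (fun p => F p \o G p).
Proof.
move=> [lF [C C0 hC] mF [B NB hB]] [lG [D D0 hD] mG [B' NB' hB']]; split.
- by move=> p a v w /=; rewrite lG lF.
- exists (C * D); first exact: mulr_ge0.
  by move=> p v /=; apply: (le_trans (hC _ _)); rewrite -mulrA ler_wpM2l.
- by move=> s ms; apply: mF; exact: mG.
- by exists (B \o B'); [exact: (sot_comp hN)|exact: implements_comp].
Qed.

Lemma good_adj F G : good_field N F -> (forall p, linear (G p)) ->
  (forall p (v w : K p), rip (F p v) w = rip v (G p w)) -> good_field N G.
Proof.
move=> [lF [C C0 hC] mF [B NB hB]] lG FG.
have hG p v : hnorm (G p v) <= C * hnorm v by exact: adjoint_bound C0 (hC p) (FG p) v.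
have mG s : msection s -> msection (fun p => G p (s p)).
  move=> ms; apply: msection_rip => t mt.
  have := measurable_rip (mF _ mt) ms.
  by under eq_fun do rewrite FG ripC.
split=> //; first by exists C.
have [B' bB' BB'] := bounded_op_adjoint (sot_bounded hN NB).
exists B'; first exact: (sot_adj hN NB).
have [B'' _ hB''] := field_op_exists lG C0 hG mG.
by apply: (implements_adj hB FG BB'); exists B''.
Qed.

(** [implements_hcvg] turns pointwise convergence of the fields into strong convergence of the
    operators, and the uniform bound lets [sot_lim] conclude. *)
Lemma good_lim (Fn : nat -> forall p, K p -> K p) F (C : R) : 0 <= C ->
  (forall n, good_field N (Fn n)) -> (forall p, linear (F p)) ->
  (forall n p v, hnorm (Fn n p v) <= C * hnorm v) ->
  (forall p v, hcvg (fun n => Fn n p v) (F p v)) -> good_field N F.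
Proof.
move=> C0 gFn lF hC cF.
have hF p v : hnorm (F p v) <= C * hnorm v.
  exact: (hcvg_hnorm_le (fun n => hC n p v) (cF p v)).
have mF s : msection s -> msection (fun p => F p (s p)).
  move=> ms; apply: (msection_lim (u := fun n p => Fn n p (s p))) => // n.
  by have [_ _ mFn _] := gFn n; exact: mFn.
split=> //; first by exists C.
have [B bB hB] := field_op_exists lF C0 hF mF; exists B => //.
have exB n : exists B, N B /\ implements (Fn n) B.
  by have [_ _ _ [B' NB' hB']] := gFn n; exists B'.
have [Bn hBn] := choice exB.
apply: (@sot_lim _ _ _ hN Bn B C); first by move=> n; have [] := hBn n.
- exact: bounded_op_lin.
- by move=> n x; have [_ h] := hBn n; exact: (implements_bound C0 h (hC n)).
- apply: (implements_hcvg hC cF _ hB) => n; by have [] := hBn n.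
Qed.

End GoodFields.

End DirectIntegral.

(** * Commutants and bicommutants as strongly closed star algebras *)

Section Commutants.
Context (R : realType) (H : hilbertType R).

Definition adj_closed (S : set (H -> H)) :=
  forall T, S T -> exists2 T', S T' & forall x y, rip (T x) y = rip x (T' y).

Lemma commutantP (S : set (H -> H)) T :
  commutant S T <-> bounded_op T /\ forall Q, S Q -> forall x, T (Q x) = Q (T x).
Proof.
split=> -[bT cT]; split=> // Q SQ; first by move=> x; have /(congr1 (@^~ x)) := cT Q SQ.
by apply/funext => x /=; exact: cT.
Qed.

Lemma sot_commutant (S : set (H -> H)) : S `<=` @bounded_op R H H -> adj_closed S ->
  sot_star_algebra (commutant S).
Proof.
move=> bS aS; split.
- by move=> T [].
- by split=> //; exact: bounded_op_id.
- move=> c T1 T2 /commutantP[b1 c1] /commutantP[b2 c2]; apply/commutantP; split.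
    exact: bounded_op_lcomb.
  by move=> Q SQ x /=; rewrite (bounded_op_lin (bS _ SQ)) c1 // c2.
- move=> T1 T2 /commutantP[b1 c1] /commutantP[b2 c2]; apply/commutantP; split.
    exact: bounded_op_comp.
  by move=> Q SQ x /=; rewrite c2 // c1.
- move=> T T' /commutantP[bT cT] bT' TT'; apply/commutantP; split=> // Q SQ x.
  have [Q' SQ' QQ'] := aS Q SQ; apply: rip_inj => y.
  by rewrite (ripC (T' _)) -TT' ripC QQ' -cT // ripC TT' QQ' ripC.
- move=> u T C cu lT hC hT; apply/commutantP; split.
    apply: (sot_lim (sot_star_algebra_bounded_op H) _ lT hC hT) => n.
    by have [] := cu n.
  move=> Q SQ x; apply: (hcvg_unique (hT (Q x))).
  have -> : (fun n => u n (Q x)) = (fun n => Q (u n x)).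
    by apply/funext => n; have /commutantP[_] := cu n; exact.
  exact: (hcvg_op (bS _ SQ) (hT x)).
Qed.

Lemma adj_closed_commutant (S : set (H -> H)) : S `<=` @bounded_op R H H ->
  adj_closed S -> adj_closed (commutant S).
Proof.
move=> bS aS T cT; have [bT _] := cT; have [T' bT' TT'] := bounded_op_adjoint bT.
by exists T' => //; exact: (sot_adj (sot_commutant bS aS) cT).
Qed.

Lemma sot_bicommutant (S : set (H -> H)) : S `<=` @bounded_op R H H -> adj_closed S ->
  sot_star_algebra (commutant (commutant S)).
Proof.
move=> bS aS; apply: sot_commutant; first by move=> T [].
exact: adj_closed_commutant.
Qed.

Lemma sub_bicommutant (S : set (H -> H)) : S `<=` @bounded_op R H H ->
  S `<=` commutant (commutant S).
Proof.
move=> bS T ST; split; first exact: bS.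
by move=> Q [_ cQ]; rewrite cQ.
Qed.

Lemma representation_range (A : cstarAlgType R) (pi : A -> H -> H) :
  representation pi -> range pi `<=` @bounded_op R H H /\ adj_closed (range pi).
Proof.
move=> [bpi _ _ api]; split; first by move=> _ [a _ <-].
move=> _ [a _ <-]; exists (pi (star a)); first by exists (star a).
by apply/adjoint_ripP; [exact/bounded_op_lin/bpi|exact: api].
Qed.

End Commutants.

(** * Rank one operators *)

Section RankOne.
Context (R : realType) (V : hilbertType R).
Implicit Types x y v : V.

Definition rank_one x y v : V := inner v y *: x.

Lemma Re_norm_le (z : R[i]) : complex.Re `|z| <= `|complex.Re z| + `|complex.Im z|.
Proof.
rewrite normc_def; case: z => a b /=.
rewrite -(@ler_pXn2r _ 2) ?nnegrE ?sqrtr_ge0 ?addr_ge0 //.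
rewrite sqr_sqrtr ?addr_ge0 ?sqr_ge0 // sqrrD !real_normK ?num_real //.
by rewrite lerD2r lerDl mulrn_wge0 // mulr_ge0.
Qed.

Lemma rip_CS_norm x y : `|rip x y| <= hnorm x * hnorm y.
Proof.
by rewrite ler_norml lerNl -ripNl rip_CS andbT -(hnorm_opp x) rip_CS.
Qed.

Lemma rank_one_bounded x y : bounded_op (rank_one x y).
Proof.
apply/bounded_opP; split; first by move=> c v w; rewrite /rank_one innerDZl scalerDl scalerA.
(* The factor 2 comes from applying the real Cauchy-Schwarz inequality separately to the real and
   imaginary parts. *)
exists (2 * hnorm y * hnorm x); first by rewrite !mulr_ge0 ?hnorm_ge0.
move=> v; rewrite /rank_one hnormZ -[leRHS]mulrAC ler_wpM2r ?hnorm_ge0 //.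
apply: (le_trans (Re_norm_le _)); rewrite inner_ripE /= normrN.
have h1 := rip_CS_norm v y; have h2 := rip_CS_norm ('i *: v) y.
rewrite hnormZi in h2; rewrite -mulrA (mulrC (hnorm y)); lra.
Qed.

Lemma rank_one_lin c x x' y v : rank_one (c *: x + x') y v = c *: rank_one x y v + rank_one x' y v.
Proof. by rewrite /rank_one scalerDr !scalerA mulrC. Qed.

Lemma rank_one_adj x y v w : rip (rank_one x y v) w = rip v (rank_one y x w).
Proof.
by rewrite /rank_one rip_conj [RHS]rip_conjr /rip !innerZ !innerZr (inner_conj w x) conjCK mulrC.
Qed.

Lemma total_orth (e : nat -> V) w :
  dense [set v | exists n (c : nat -> R[i]), v = \sum_(k < n) c k *: e k] ->
  (forall k, inner (e k) w = 0) -> w = 0.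
Proof.
move=> de ew; apply/eqP; case: (eqVneq (hnorm w) 0) => [/hnorm_eq0/eqP //|wn0].
have w0 : 0 < hnorm w by rewrite lt_neqAle eq_sym wn0 hnorm_ge0.
have [y [n [c yE]] hy] := dense_hnorm w de w0.
have yw : rip y w = 0.
  rewrite yE rip_suml big1 // => k _; by rewrite /rip innerZ ew mulr0.
have h := rip_CS (w - y) w; rewrite ripBl yw subr0 ripE hnormC expr2 in h.
by move: h; rewrite ler_pM2r // leNgt hy.
Qed.

End RankOne.

(** * The algebra attached to an equivalence class of fibers *)

Section EquivalenceClass.
Context (R : realType) (d : measure_display) (X : measurableType d).
Context (mu : {finite_measure set X -> \bar R}) (K : hilbert_field R X).
Context (H : hilbertType R) (W : H -> forall p, K p).
Hypothesis hW : unitary_onto_direct_integral mu W.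
Context (A : cstarAlgType R) (pi : A -> H -> H).
Unset Implicit Arguments.
Context (pi_ : forall p, A -> K p -> K p).
Set Implicit Arguments.
Hypothesis repr_pi_ : measurable_representations pi_.
Context (N : set (H -> H)) (hN : sot_star_algebra N).
Hypothesis N_pi : forall a, N (pi a).
Hypothesis pi_W : forall a, implements mu W (fun p => pi_ p a) (pi a).

Context (E : set X) (p0 : X) (mE : measurable E) (PE : H -> H).
Hypothesis N_PE : N PE.
Hypothesis PE_W : implements mu W (fun p v => if p \in E then v else 0) PE.
Hypothesis irr_p0 : irreducible (pi_ p0).

Unset Implicit Arguments.
Context (U : forall q, K q -> K p0) (J : forall q, K p0 -> K q).
Set Implicit Arguments.
Hypothesis linU : forall q, q \in E -> linear (U q).
Hypothesis ripU : forall q, q \in E -> forall v w, rip (U q v) (U q w) = rip v w.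
Hypothesis UJ : forall q, q \in E -> forall x, U q (J q x) = x.
Hypothesis Upi : forall q, q \in E -> forall a v, U q (pi_ q a v) = pi_ p0 a (U q v).

Let ripJU q : q \in E -> forall x v, rip (J q x) v = rip x (U q v).
Proof. by move=> qE x v; rewrite -ripU // UJ. Qed.

Let JU q : q \in E -> forall v, J q (U q v) = v.
Proof. by move=> qE v; apply: rip_inj => w; rewrite ripJU // ripU. Qed.

Let linJ q : q \in E -> linear (J q).
Proof.
move=> qE c x y; apply: rip_inj => v; rewrite ripJU // !ripDl ripJU //.
by rewrite [in RHS]rip_conj ripJU // (linearZ_of (linU qE)) rip_conj.
Qed.

Let hnormU q : q \in E -> forall v, hnorm (U q v) = hnorm v.
Proof.
move=> qE v; apply/eqP; rewrite -(@eqrXn2 _ 2) ?hnorm_ge0 //.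
by rewrite -!ripE ripU.
Qed.

Let hnormJ q : q \in E -> forall x, hnorm (J q x) = hnorm x.
Proof. by move=> qE x; rewrite -(hnormU qE) UJ. Qed.

(** Nothing is assumed on how [U q] depends on [q], so measurability of this field is a theorem,
    [transport_good]. Being zero off [E], it sends [id] to the indicator field of [E]. *)
Definition transport (T : K p0 -> K p0) : forall q, K q -> K q :=
  fun q v => if q \in E then J q (T (U q v)) else 0.

Lemma transport_linear T q : linear T -> linear (@transport T q).
Proof.
move=> lT c v w; rewrite /transport; case: ifP => [qE|_]; last by rewrite scaler0 addr0.
by rewrite (linU qE) lT (linJ qE).
Qed.

Lemma transport_bound (T : K p0 -> K p0) (C : R) q v : 0 <= C ->
  (forall x, hnorm (T x) <= C * hnorm x) -> hnorm (@transport T q v) <= C * hnorm v.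
Proof.
move=> C0 hC; rewrite /transport; case: ifP => [qE|_].
  by have := hC (U q v); rewrite hnormU // hnormJ.
by rewrite hnorm0 mulr_ge0 ?hnorm_ge0.
Qed.

Lemma transport_lcomb c (S T : K p0 -> K p0) :
  transport ((c \*: S) \+ T) = fun q => (c \*: @transport S q) \+ @transport T q.
Proof.
apply: functional_extensionality_dep => q; apply/funext => v.
rewrite /transport /=; case: ifP => [qE|_]; first by rewrite (linJ qE).
by rewrite scaler0 addr0.
Qed.

Lemma transport_comp (S T : K p0 -> K p0) :
  transport (S \o T) = fun q => @transport S q \o @transport T q.
Proof.
apply: functional_extensionality_dep => q; apply/funext => v.
by rewrite /transport /=; case: ifP => [qE|//]; rewrite UJ.
Qed.

Lemma transport_id : transport id = fun q v => if q \in E then v else 0.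
Proof.
apply: functional_extensionality_dep => q; apply/funext => v.
by rewrite /transport; case: ifP => // qE; rewrite JU.
Qed.

Lemma transport_adj (S T : K p0 -> K p0) : (forall x y, rip (S x) y = rip x (T y)) ->
  forall q v w, rip (@transport S q v) w = rip v (@transport T q w).
Proof.
move=> ST q v w; rewrite /transport; case: ifP => [qE|_]; last by rewrite rip0l rip0r.
by rewrite ripJU // ST ripC -ripJU // ripC.
Qed.

(** The intertwining relation cancels the unitaries, so these fields, unlike a general
    [transport T], are visibly measurable. *)
Lemma transport_pi a :
  transport (pi_ p0 a) = fun q => @transport id q \o pi_ q a.
Proof.
apply: functional_extensionality_dep => q; apply/funext => v.
by rewrite /transport /=; case: ifP => // qE; rewrite Upi.
Qed.

Lemma transport_id_good : good_field mu W N (transport id).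
Proof.
rewrite transport_id; split.
- by move=> q c v w; case: ifP => // _; rewrite scaler0 addr0.
- exists 1 => // q v; case: ifP => _; rewrite mul1r //.
  by rewrite hnorm0 hnorm_ge0.
- move=> s ms; have := msection_scale (@measurable_indic _ X R setT E mE) ms.
  congr msection; apply: functional_extensionality_dep => q; rewrite indicE.
  by case: ifP => _; rewrite ?scale1r ?scale0r.
- by exists PE.
Qed.

Lemma transport_pi_good a : good_field mu W N (transport (pi_ p0 a)).
Proof.
rewrite transport_pi; case: transport_id_good => l1 [C C0 hC] m1 _.
have bq q : bounded_op (pi_ q a) by have [/(_ q)[b _ _ _] _] := repr_pi_; exact: b.
have /bounded_opP[_ [D D0 hD]] := bq p0.
split.
- by move=> q c v w /=; rewrite (bounded_op_lin (bq q)) l1.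
- exists D => // q v; have := @transport_bound (pi_ p0 a) D q v D0 hD.
  by rewrite transport_pi.
- by move=> s ms; apply: m1; have [_ m2] := repr_pi_; exact: m2.
- exists (PE \o pi a); first exact: (sot_comp hN).
  by rewrite transport_id; exact: (implements_comp PE_W (pi_W a)).
Qed.

Let M0 : set (K p0 -> K p0) :=
  [set T | bounded_op T /\ good_field mu W N (transport T)].

Lemma transport_algebra : sot_star_algebra M0.
Proof.
split.
- by move=> T [].
- by split; [exact: bounded_op_id|exact: transport_id_good].
- move=> c S T [bS gS] [bT gT]; split; first exact: bounded_op_lcomb.
  by rewrite transport_lcomb; exact: (good_lcomb hW hN).
- move=> S T [bS gS] [bT gT]; split; first exact: bounded_op_comp.
  by rewrite transport_comp; exact: (good_comp hN).
- move=> T S [bT gT] bS TS; split=> //.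
  apply: (good_adj hW hN gT) => [q|]; last exact: transport_adj.
  by apply: transport_linear; exact: bounded_op_lin.
- move=> u T C hu lT hC hT; split.
    apply: (sot_lim (sot_star_algebra_bounded_op _) _ lT hC hT) => n.
    by have [] := hu n.
  have hC' n x : hnorm (u n x) <= `|C| * hnorm x.
    by apply: (le_trans (hC n x)); rewrite ler_wpM2r ?hnorm_ge0 // ler_norm.
  apply: (@good_lim _ _ _ mu _ _ _ hW N hN (fun n => transport (u n)) _ `|C|) => //.
  + by move=> n; have [] := hu n.
  + by move=> q; exact: transport_linear.
  + by move=> n q v; exact: transport_bound.
  + move=> q v; rewrite /transport; case: ifP => qE; last exact: hcvg_cst.
    apply: (hcvg_le _ (hT (U q v))) => n.
    by rewrite -(linearB_of (linJ qE)) hnormJ.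
Qed.

Lemma transport_good T : bounded_op T -> good_field mu W N (transport T).
Proof.
move=> bT; suff : M0 T by case.
have [e [_ /(_ p0) de]] := msection_total K.
apply: (@irreducible_full _ _ M0 transport_algebra _ (fun k => e k p0) de T bT) => Y cY invY.
have [_ irr] := irr_p0; apply: irr => // a x Yx.
apply: invY => //; split; last exact: transport_pi_good.
by have [/(_ p0)[b _ _ _] _] := repr_pi_; exact: b.
Qed.

Lemma transport_op : exists rho : (K p0 -> K p0) -> H -> H,
  forall T, bounded_op T -> N (rho T) /\ implements mu W (transport T) (rho T).
Proof.
have ex T : exists B, bounded_op T -> N B /\ implements mu W (transport T) B.
  have [bT|nbT] := pselect (bounded_op T); last by exists id.
  by have [_ _ _ [B NB hB]] := transport_good bT; exists B.
by have [rho hrho] := choice ex; exists rho.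
Qed.

(* A unit vector [eta] in the range of the image of a rank one projection
   generates a copy of the fiber representation inside [H]. *)
Lemma class_intertwiner : mu E != 0%E -> exists V : K p0 -> H,
  [/\ linear V, forall x y, rip (V x) (V y) = rip x y, forall x, PE (V x) = V x &
   forall a x y, rip (pi a (V x)) (V y) = rip (pi_ p0 a x) y].
Proof.
move=> muE; have [rho hrho] := transport_op.
have rhoW T : bounded_op T -> implements mu W (transport T) (rho T).
  by move=> bT; have [] := hrho T bT.
have rho_eq T B : bounded_op T -> implements mu W (transport T) B -> rho T = B.
  by move=> bT; apply: (implements_unique hW); exact: rhoW.
have rho_lcomb c S T : bounded_op S -> bounded_op T ->
    rho ((c \*: S) \+ T) = (c \*: rho S) \+ rho T.
  move=> bS bT; apply: rho_eq; first exact: bounded_op_lcomb.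
  by rewrite transport_lcomb; apply: (implements_lcomb hW); exact: rhoW.
have rho_comp S T : bounded_op S -> bounded_op T -> rho (S \o T) = rho S \o rho T.
  move=> bS bT; apply: rho_eq; first exact: bounded_op_comp.
  by rewrite transport_comp; apply: implements_comp; exact: rhoW.
have rho_id : rho id = PE.
  by apply: rho_eq; [exact: bounded_op_id|rewrite transport_id].
have rho_adj S T : bounded_op S -> bounded_op T -> (forall x y, rip (S x) y = rip x (T y)) ->
    forall x y, rip (rho S x) y = rip x (rho T y).
  move=> bS bT ST x y; apply: (rip_ae_eq hW).
  apply: filterS2 (rhoW S bS x) (rhoW T bT y) => q -> ->.
  exact: transport_adj.
have bpi a : bounded_op (pi_ p0 a).
  by have [/(_ p0)[b _ _ _] _] := repr_pi_; exact: b.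
have rho_pi a : rho (pi_ p0 a) = PE \o pi a.
  apply: rho_eq => //; rewrite transport_pi transport_id.
  exact: (implements_comp PE_W (pi_W a)).
have [xi0 xi0n] : exists x : K p0, x <> 0.
  have [[a [x ax]] _] := irr_p0; exists x => x0; apply: ax.
  by rewrite x0 (linear0_of (bounded_op_lin (bpi a))).
pose xi := ((hnorm xi0)^-1)%:C *: xi0.
have xi0p : 0 < hnorm xi0 by rewrite lt_neqAle hnorm_ge0 andbT eq_sym; apply/eqP => /hnorm_eq0.
have xi1 : hnorm xi = 1 by rewrite hnormZr gtr0_norm ?invr_gt0 // mulVf // gt_eqF.
have inxi : inner xi xi = 1 by rewrite inner_normE normE xi1 expr1n.
pose e := rank_one xi xi.
have be : bounded_op e by exact: rank_one_bounded.
(* This is where [mu E != 0] enters: if [rho e] were zero, [transport e] would annihilate a total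
   family in almost every fiber. *)
have [x0 ex0] : exists x, rho e x <> 0.
  apply: contrapT => hno.
  have rho0 x : rho e x = 0 by apply: contrapT => h; apply: hno; exists x.
  have [s [ms ds]] := msection_total K.
  (* The total sections need not be square integrable. A positive weight brings their norm below 1,
     since [h <= expR h], and leaves their spans unchanged. *)
  pose f k (q : X) : R := expR (- hnorm (s k q)).
  pose t k q := (f k q)%:C *: s k q.
  have mt k : msection (t k).
    apply: msection_scale => //; apply: measurableT_comp; first exact: measurable_expR.
    by apply: measurable_funN; exact: msection_norm.
  have t1 k q : hnorm (t k q) <= 1.
    rewrite hnormZr gtr0_norm ?expR_gt0 // /f expRN mulrC ler_pdivrMr ?expR_gt0 // mul1r.
    by apply: (le_trans _ (expR_ge1Dx _)); rewrite lerDr.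
  have exz k : exists z, {ae mu, forall q, W z q = t k q}.
    have [_ _ _ surj] := hW; apply: surj => //.
    apply: (@le_lt_trans _ _ (\int[mu]_q 1%:E)%E).
      apply: ae_ge0_le_integral => //.
      - by move=> q _; rewrite lee_fin sqr_ge0.
      - by apply/measurable_EFinP/measurable_hnorm2.
      - apply: aeW => q _; rewrite lee_fin -(expr1n _ 2).
        by rewrite ler_pXn2r ?nnegrE ?hnorm_ge0.
    rewrite integral_cst // mul1e.
    exact: (fin_num_fun_lty (@fin_num_measure _ _ _ mu)).
  have [z hz] := choice exz.
  have hae : {ae mu, forall q, forall k, transport e (t k q) = 0}.
    apply: ae_foralln => k; have := W_0 hW; have := rhoW e be (z k).
    by rewrite rho0; apply: filterS3 (hz k) => q -> <-.
  have negE : mu.-negligible E.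
    apply: negligibleS hae => q Eq /= h.
    have qE : q \in E by rewrite inE.
    (* Cancelling [J q] and the positive weight leaves [J q xi] orthogonal to every [s k q]. *)
    have Jxi0 : J q xi = 0.
      apply: (@total_orth _ _ (fun k => s k q) _ (ds q)) => k; have := h k.
      rewrite /transport qE => /(congr1 (U q)); rewrite UJ // (linear0_of (linU qE)).
      rewrite /e /rank_one => e0.
      have i0 : inner (U q (t k q)) xi = 0.
        by rewrite -[LHS]mulr1 -inxi -innerZ e0 inner0l.
      have : inner (t k q) (J q xi) = 0.
        rewrite -i0 !inner_ripE -(linearZ_of (linU qE)).
        by rewrite !(ripC _ (J q xi)) !ripJU // !(ripC xi).
      rewrite /t innerZ => /eqP; rewrite mulf_eq0 => /orP[|/eqP //].
      by move=> /eqP [] fz; have := expR_gt0 (- hnorm (s k q)); rewrite -/(f k q) fz ltxx.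
    have : xi = 0 by rewrite -(UJ qE xi) Jxi0 (linear0_of (linU qE)).
    by move=> xi00; move: xi1; rewrite xi00 hnorm0 => /eqP; rewrite eq_sym oner_eq0.
  by move/eqP: muE; apply; apply/measure_negligible.
pose eta := ((hnorm (rho e x0))^-1)%:C *: rho e x0.
have nx0 : 0 < hnorm (rho e x0).
  by rewrite lt_neqAle hnorm_ge0 andbT eq_sym; apply/eqP => /hnorm_eq0.
have eta1 : hnorm eta = 1 by rewrite hnormZr gtr0_norm ?invr_gt0 // mulVf // gt_eqF.
have bN T : bounded_op T -> bounded_op (rho T).
  by move=> bT; apply: (sot_bounded hN); have [] := hrho T bT.
have ee : e \o e = e.
  by apply/funext => v; rewrite /= /e /rank_one innerZ inxi mulr1.
have eeta : rho e eta = eta.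
  have lre := bounded_op_lin (bN e be).
  rewrite /eta (linearZ_of lre); congr (_ *: _).
  by rewrite -[LHS]/((rho e \o rho e) x0) -rho_comp // ee.
have bth x : bounded_op (rank_one x xi) by exact: rank_one_bounded.
(* The product [rank_one xi y \o rank_one x xi] is [inner x y] times [e], and [rho e] fixes the unit
   vector [eta]. The added zero operator puts this multiple in the shape of [rho_lcomb]. *)
have ripV x y : rip (rho (rank_one x xi) eta) (rho (rank_one y xi) eta) = rip x y.
  have byt : bounded_op (rank_one xi y) by exact: rank_one_bounded.
  rewrite ripC (rho_adj _ _ (bth y) byt); last exact: rank_one_adj.
  rewrite -[rho _ (rho _ _)]/((rho (rank_one xi y) \o rho (rank_one x xi)) eta) -rho_comp //.
  have -> : rank_one xi y \o rank_one x xi = (inner x y \*: e) \+ (fun=> 0).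
    by apply/funext => v; rewrite /= /e /rank_one innerZ addr0 scalerA mulrC.
  have b0 : bounded_op (fun=> 0 : K p0) := sot_zero (sot_star_algebra_bounded_op _).
  have r0 : rho (fun=> 0) = fun=> 0.
    apply/funext => v; have := rho_lcomb (-1) _ _ b0 b0.
    have -> : ((-1 : R[i]) \*: (fun=> 0 : K p0)) \+ (fun=> 0) = (fun=> 0 : K p0) :> (K p0 -> K p0).
      by apply/funext => w; rewrite /= scaler0 addr0.
    by move=> /(congr1 (@^~ v)) /= ->; rewrite scaleN1r addNr.
  rewrite rho_lcomb // r0 /= addr0 eeta rip_conjr ripC /rip.
  by rewrite innerZr conjCK inner_normE normE eta1 expr1n mulr1.
exists (fun x => rho (rank_one x xi) eta); split.
- move=> c x y.
  have -> : rank_one (c *: x + y) xi = (c \*: rank_one x xi) \+ rank_one y xi.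
    by apply/funext => v; rewrite rank_one_lin.
  by rewrite rho_lcomb.
- exact: ripV.
- move=> x; rewrite -rho_id -[LHS]/((rho id \o rho (rank_one x xi)) eta).
  by rewrite -rho_comp //; exact: bounded_op_id.
- move=> a x y.
  have PEa (w z : H) : PE z = z -> rip w z = rip (PE w) z.
    have bid := @bounded_op_id R (K p0).
    by move=> h; rewrite -{1}h -rho_id (rho_adj _ _ bid bid).
  rewrite PEa; last first.
    rewrite -rho_id -[LHS]/((rho id \o rho (rank_one y xi)) eta).
    by rewrite -rho_comp //; exact: bounded_op_id.
  have -> : PE (pi a (rho (rank_one x xi) eta)) = rho (rank_one (pi_ p0 a x) xi) eta.
    rewrite -[LHS]/((PE \o pi a) (rho (rank_one x xi) eta)) -rho_pi.
    rewrite -[LHS]/((rho (pi_ p0 a) \o rho (rank_one x xi)) eta) -rho_comp //.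
    congr (rho _ eta); apply/funext => v; rewrite /= /rank_one.
    exact: (linearZ_of (bounded_op_lin (bpi a))).
  exact: ripV.
Qed.

End EquivalenceClass.

(** * Unitary equivalence, and the expectation on a single class *)

Section UnitaryEquivalence.
Context (R : realType) (A : cstarAlgType R).

Lemma unitarily_equivalentP (V1 V2 : hilbertType R) (pi1 : A -> V1 -> V1) (pi2 : A -> V2 -> V2) :
  unitarily_equivalent pi1 pi2 -> exists UJ : (V1 -> V2) * (V2 -> V1),
    [/\ linear UJ.1, forall v w, rip (UJ.1 v) (UJ.1 w) = rip v w,
        forall x, UJ.1 (UJ.2 x) = x & forall a v, UJ.1 (pi1 a v) = pi2 a (UJ.1 v)].
Proof.
move=> [U [lU iU sU cU]]; have [J hJ] := choice sU.
exists (U, J); split=> //= [v w|a v]; first by rewrite /rip iU.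
by have /(congr1 (@^~ v)) := cU a.
Qed.

Lemma unitarily_equivalent_sym (V1 V2 : hilbertType R) (pi1 : A -> V1 -> V1)
  (pi2 : A -> V2 -> V2) : unitarily_equivalent pi1 pi2 -> unitarily_equivalent pi2 pi1.
Proof.
move=> [U [lU iU sU cU]]; have [J hJ] := choice sU.
have JU v : J (U v) = v.
  by apply: rip_inj => z; rewrite /rip -iU hJ iU.
have Ui v w : U v = U w -> v = w by move=> h; rewrite -(JU v) h JU.
exists J; split.
- by move=> c x y; apply: Ui; rewrite hJ lU !hJ.
- by move=> x y; rewrite -iU !hJ.
- by move=> v; exists (U v).
- move=> a; apply/funext => x; apply: Ui; rewrite /= hJ.
  by have /(congr1 (@^~ (J x))) /= -> := cU a; rewrite hJ.
Qed.

Lemma unitarily_equivalent_trans (V1 V2 V3 : hilbertType R) (pi1 : A -> V1 -> V1)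
  (pi2 : A -> V2 -> V2) (pi3 : A -> V3 -> V3) : unitarily_equivalent pi1 pi2 ->
  unitarily_equivalent pi2 pi3 -> unitarily_equivalent pi1 pi3.
Proof.
move=> [U [lU iU sU cU]] [U' [lU' iU' sU' cU']]; exists (U' \o U); split.
- by move=> c x y /=; rewrite lU lU'.
- by move=> x y /=; rewrite iU' iU.
- by move=> z; have [y <-] := sU' z; have [x <-] := sU y; exists x.
- move=> a; apply/funext => x /=.
  have /(congr1 (@^~ x)) /= -> := cU a.
  by have /(congr1 (@^~ (U x))) /= -> := cU' a.
Qed.

Lemma unitarily_equivalent_refl (V : hilbertType R) (pi : A -> V -> V) :
  unitarily_equivalent pi pi.
Proof. by exists id; split=> // y; exists y. Qed.

Lemma adjoint_inner (V1 V2 : hilbertType R) (S : V1 -> V2) (T : V2 -> V1) : linear S ->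
  (forall x y, rip (S x) y = rip x (T y)) -> forall x y, inner (S x) y = inner x (T y).
Proof. by move=> lS ST x y; rewrite !inner_ripE -(linearZ_of lS) !ST. Qed.

End UnitaryEquivalence.

Section ClassExpectation.
Context (R : realType) (d : measure_display) (X : measurableType d).
Context (mu : {finite_measure set X -> \bar R}) (K : hilbert_field R X).
Context (H : hilbertType R) (W : H -> forall p, K p).
Hypothesis hW : unitary_onto_direct_integral mu W.
Context (A : cstarAlgType R) (pi : A -> H -> H).
Unset Implicit Arguments.
Context (pi_ : forall p, A -> K p -> K p).
Set Implicit Arguments.
Hypothesis repr_pi_ : measurable_representations pi_.
Context (N : set (H -> H)) (hN : sot_star_algebra N).
Hypothesis N_pi : forall a, N (pi a).
Hypothesis pi_W : forall a, implements mu W (fun p => pi_ p a) (pi a).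

(* The restriction to one class of the weak expectation sought: compress by the
   intertwining isometry [V : K p0 -> H], then transport to every fiber of the
   class. *)
Lemma class_expectation (E : set X) (p0 : X) (PE : H -> H) : measurable E -> N PE ->
  implements mu W (fun (p : X) (v : K p) => if p \in E then v else 0) PE ->
  irreducible (pi_ p0) -> (forall q, E q -> unitarily_equivalent (pi_ q) (pi_ p0)) ->
  mu E != 0%E ->
  exists G : (H -> H) -> forall q, K q -> K q,
  [/\ (forall T, bounded_op T -> good_field mu W N (G T)),
      (forall T q v, q \notin E -> G T q v = 0),
      (forall T (C : R), 0 <= C -> (forall x, hnorm (T x) <= C * hnorm x) ->
         forall q v, hnorm (G T q v) <= C * hnorm v),
      (forall c S T q v, G ((c \*: S) \+ T) q v = c *: G S q v + G T q v) &
   [/\ (forall q v, q \in E -> G id q v = v),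
       (forall a q v, q \in E -> G (pi a) q v = pi_ q a v),
       (forall n (T : 'I_n -> 'I_n -> H -> H), positive_opmx T ->
          forall q (w : 'I_n -> K q),
            0 <= \sum_(i < n) \sum_(j < n) inner (G (T i j) q (w j)) (w i)),
       (forall P T, (forall x y, rip (P x) y = rip x (P y)) ->
          (forall x, PE x = x -> P x = x) -> G (P \o T) = G T) &
       (forall P T q v, (forall x y, rip (P x) y = rip x (P y)) ->
          (forall x, PE x = x -> P x = 0) -> G (P \o T) q v = 0)]].
Proof.
move=> mE N_PE PE_W irr eqE muE.
(* The types vary with [q], so the unitaries are kept in a sigma type; off [E] zero maps fill in. *)
have exUJ q : {UJ : (K q -> K p0) * (K p0 -> K q) | q \in E ->
    [/\ linear UJ.1, forall v w, rip (UJ.1 v) (UJ.1 w) = rip v w,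
        forall x, UJ.1 (UJ.2 x) = x & forall a v, UJ.1 (pi_ q a v) = pi_ p0 a (UJ.1 v)]}.
  apply: cid; have [qE|] := boolP (q \in E); last by exists ((fun=> 0), (fun=> 0)).
  have [|UJ hUJ] := unitarily_equivalentP (eqE q _); first by rewrite inE in qE.
  by exists UJ.
pose U q := (sval (exUJ q)).1; pose J q := (sval (exUJ q)).2.
have linU q : q \in E -> linear (U q) by move=> qE; have [] := svalP (exUJ q) qE.
have ripU q : q \in E -> forall v w, rip (U q v) (U q w) = rip v w.
  by move=> qE; have [] := svalP (exUJ q) qE.
have UJ q : q \in E -> forall x, U q (J q x) = x.
  by move=> qE; have [] := svalP (exUJ q) qE.
have Upi q : q \in E -> forall a v, U q (pi_ q a v) = pi_ p0 a (U q v).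
  by move=> qE; have [] := svalP (exUJ q) qE.
have JU q : q \in E -> forall v, J q (U q v) = v.
  by move=> qE v; apply: rip_inj => w; rewrite -ripU // UJ // ripU.
have [V [lV iV PV piV]] := class_intertwiner hW repr_pi_ hN N_pi pi_W mE N_PE PE_W irr
  linU ripU UJ Upi muE.
have tgood := transport_good hW repr_pi_ hN N_pi pi_W mE N_PE PE_W irr linU ripU UJ Upi.
have hV x : hnorm (V x) <= 1 * hnorm x.
  by rewrite mul1r -(@ler_pXn2r _ 2) ?nnegrE ?hnorm_ge0 // -!ripE iV.
have bV : bounded_op V by apply/bounded_opP; split=> //; exists 1.
have [V' bV' VV'] := bounded_op_adjoint bV.
have lV' := bounded_op_lin bV'.
have hV' y : hnorm (V' y) <= hnorm y by rewrite -[leRHS]mul1r (adjoint_bound ler01 hV VV').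
have V'V x : V' (V x) = x.
  by apply: rip_inj => z; rewrite ripC -VV' iV ripC.
(* It is unital because [V] is isometric, and sends [pi a] to [pi_ p0 a] by [piV]. *)
pose psi (T : H -> H) := V' \o T \o V.
have psi_b T : bounded_op T -> bounded_op (psi T).
  by move=> bT; do 2 apply: bounded_op_comp => //.
pose G (T : H -> H) : forall q, K q -> K q := fun q v => transport E U J (psi T) v.
have tid q v : q \in E -> transport E U J id v = v :> K q.
  by move=> qE; rewrite /transport qE JU.
exists G; split.
- by move=> T bT; apply: tgood; exact: psi_b.
- by move=> T q v /negPf qE; rewrite /G /transport qE.
- move=> T C C0 hC q v; apply: transport_bound => // x.
  apply: (le_trans (hV' _)); apply: (le_trans (hC _)).
  by rewrite ler_wpM2l //; have := hV x; rewrite mul1r.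
- move=> c S T q v; rewrite /G.
  have -> : psi ((c \*: S) \+ T) = (c \*: psi S) \+ psi T.
    by apply/funext => x; rewrite /psi /= lV'.
  by rewrite transport_lcomb.
split.
- move=> q v qE; rewrite /G; have -> : psi id = id by apply/funext => x; rewrite /psi /= V'V.
  exact: tid.
- move=> a q v qE; rewrite /G.
  have -> : psi (pi a) = pi_ p0 a.
    by apply/funext => x; apply: rip_inj => z; rewrite /psi /= ripC -VV' ripC piV.
  by rewrite /transport qE -Upi // JU.
(* Positivity at the fiber vectors [w i] is that of [T] at the vectors [V (U q (w i))] of [H]. *)
- move=> n T posT q w; rewrite /G /transport; have [qE|/negPf qE] := boolP (q \in E); last first.
    by rewrite big1 // => i _; rewrite big1 // => j _; rewrite inner0l.
  have := posT (fun i => V (U q (w i))).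
  have innerJ x v : inner (J q x) v = inner x (U q v).
    have ripJ y z : rip (U q y) z = rip y (J q z) by rewrite -{1}(UJ q qE z) ripU.
    by rewrite inner_conj -(adjoint_inner (linU q qE) ripJ) -inner_conj.
  have innerV' x y : inner (V' x) y = inner x (V y).
    by rewrite inner_conj -(adjoint_inner lV VV') -inner_conj.
  congr (0 <= _); apply: eq_bigr => i _; apply: eq_bigr => j _.
  by rewrite innerJ /psi /= innerV'.
(* Moving the selfadjoint [P] to the other side of the pairing makes it act on [V z], which [PE]
   fixes. *)
- move=> P T sP PP; rewrite /G; congr (fun F => fun q v => transport E U J F v).
  apply/funext => x; apply: rip_inj => z; rewrite /psi /=.
  by rewrite !(ripC _ z) -!VV' !(ripC (V z)) sP PP.
- move=> P T q v sP PP; rewrite /G; have -> : psi (P \o T) = fun=> 0.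
    apply/funext => x; apply: rip_inj => z; rewrite /psi /= rip0l.
    by rewrite ripC -VV' ripC sP PP // rip0r.
  rewrite /transport; case: ifP => // qE.
  by have := JU q qE 0; rewrite (linear0_of (linU q qE)).
Qed.

End ClassExpectation.

(** * The weak expectation *)

Section Main.
Context (R : realType) (A : cstarAlgType R) (H : hilbertType R).
Context (pi : A -> H -> H) (d : measure_display) (X : measurableType d).
Context (mu : {finite_measure set X -> \bar R}) (K : hilbert_field R X).
Context (W : H -> forall p, K p).
Unset Implicit Arguments.
Context (pi_ : forall p, A -> K p -> K p).
Set Implicit Arguments.
Hypothesis hW : unitary_onto_direct_integral mu W.
Hypothesis repr_pi_ : measurable_representations pi_.
Hypothesis pi_W : forall a, implements mu W (fun p => pi_ p a) (pi a).
Hypothesis urep : unital_representation pi.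

Let N := commutant (commutant (range pi)).

Let hN : sot_star_algebra N.
Proof.
have [rp _] := urep; have [bp ap] := representation_range rp.
exact: sot_bicommutant.
Qed.

Let N_pi a : N (pi a).
Proof.
have [rp _] := urep; have [bp _] := representation_range rp.
by apply: (sub_bicommutant bp); exists a.
Qed.

Let chi (E : set X) : forall p, K p -> K p := fun p v => if p \in E then v else 0.

Lemma chi_section E s : measurable E -> msection s -> msection (fun p => @chi E p (s p)).
Proof.
move=> mE ms; have := msection_scale (@measurable_indic _ X R setT E mE) ms.
congr msection; apply: functional_extensionality_dep => q; rewrite indicE /chi.
by case: ifP => _; rewrite ?scale1r ?scale0r.
Qed.

Lemma chi_linear E p : linear (@chi E p).
Proof. by move=> c v w; rewrite /chi; case: ifP => // _; rewrite scaler0 addr0. Qed.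

Lemma chi_bound E p (v : K p) : hnorm (chi E v) <= 1 * hnorm v.
Proof. by rewrite mul1r /chi; case: ifP => // _; rewrite hnorm0 hnorm_ge0. Qed.

Lemma chi_indic E p (v : K p) : (\1_E p : R[i]) *: v = chi E v.
Proof. by rewrite indicE /chi; case: ifP => _; rewrite ?scale1r ?scale0r. Qed.

Lemma diagonal_indicP E P : diagonal_op mu W (fun q => \1_E q) P <->
  bounded_op P /\ implements mu W (chi E) P.
Proof.
by split=> -[bP h]; split=> // x; apply: filterS (h x) => p ->; rewrite chi_indic.
Qed.

Lemma indic_operator_exists E : measurable E ->
  exists2 P, bounded_op P & implements mu W (chi E) P.
Proof.
move=> mE; apply: (field_op_exists hW (C := 1)) => //.
- by move=> q; exact: chi_linear.
- by move=> q v; exact: chi_bound.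
- by move=> s; exact: chi_section.
Qed.

Lemma class_projection_of_expectation Phi P :
  decomposable_weak_expectation mu W pi pi_ Phi ->
  class_projections mu W pi_ P -> N P.
Proof.
move=> [[PhiN _ Phi1 _] PhiP] cP.
have [X0 [p [[_ _ _ mE] X0p _ dP]]] := cP.
have [bP iP] := (diagonal_indicP _ _).1 dP.
have decP : decomposable_ops mu W P.
  split=> //; exists (chi (fiber_equiv_class pi_ X0 p)); split.
  - move=> q; apply/bounded_opP; split; first exact: chi_linear.
    by exists 1 => // v; exact: chi_bound.
  - by move=> s ms; apply: chi_section => //; exact: mE.
  - by exists 1; apply: aeW => q v; exact: chi_bound.
  - exact: iP.
have decI : decomposable_ops mu W id.
  split; first exact: bounded_op_id.
  exists (fun p => id); split=> //.
  - by move=> q; exact: bounded_op_id.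
  - by exists 1; apply: aeW => q v; rewrite mul1r.
  - by move=> x; apply: aeW.
have := PhiP P id cP decI; rewrite Phi1.
by have := PhiN P decP; rewrite -/N => NP; rewrite (_ : P \o id = P) // => <-.
Qed.

Hypothesis projN : class_projections mu W pi_ `<=` N.
Context (X0 : set X).
Hypothesis dX0 : decomposing_null_set mu pi_ X0.

Let cls p := fiber_equiv_class pi_ X0 p.

Let cls_self p : ~ X0 p -> cls p p.
Proof. by move=> h; split=> //; exact: unitarily_equivalent_refl. Qed.

Let cls_eq p q : cls p q -> cls q = cls p.
Proof.
move=> [X0q qp]; apply/seteqP; split=> r [X0r rq]; split=> //.
  exact: unitarily_equivalent_trans rq qp.
exact: (unitarily_equivalent_trans rq (unitarily_equivalent_sym qp)).
Qed.

Lemma class_enumeration : (exists p, ~ X0 p) -> exists p_ : nat -> X,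
  (forall n, ~ X0 (p_ n)) /\ forall q, ~ X0 q -> exists n, cls (p_ n) = cls q.
Proof.
move=> [p0 X0p0]; have [_ _ cnt _] := dX0.
have : ([set cls p | p in ~` X0] #<= [set: nat])%card by exact: cnt.
move=> /pfcard_geP[e0|[f]].
  have : [set cls p | p in ~` X0] (cls p0) by exists p0.
  by rewrite e0.
have exp n : exists p, ~ X0 p /\ cls p = f n.
  have [p hp <-] : [set cls p | p in ~` X0] (f n) by exact: funS.
  by exists p.
have [p_ hp_] := choice exp.
exists p_; split=> [n|q X0q]; first by have [] := hp_ n.
have [|n _ fn] := @surj _ _ _ _ f (cls q); first by exists q.
by exists n; rewrite (hp_ n).2.
Qed.

Let ae_X0 : {ae mu, forall q, ~ X0 q}.
Proof. by have [neg _ _ _] := dX0; apply: negligibleS neg => q /contrapT. Qed.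

Let zero_good : good_field mu W N (fun p (v : K p) => 0).
Proof.
split.
- by move=> p c v w; rewrite scaler0 addr0.
- by exists 0 => // p v; rewrite hnorm0 mul0r.
- by move=> s _; exact: msection0.
- exists (fun=> 0); first exact: (sot_zero hN).
  by move=> x; exact: (W_0 hW).
Qed.

(** Here the whole of [X] is negligible, so [H] is trivial and every operator equals [id]. *)
Lemma weak_expectation_degenerate : ~ (exists p, ~ X0 p) ->
  decomposable_weak_expectation mu W pi pi_ (fun T => T).
Proof.
move=> noX; have triv (x y : H) : x = y.
  apply: (W_inj hW); apply: filterS ae_X0 => p hp; exfalso; apply: noX.
  by exists p.
split=> //; split=> // T _; rewrite -/N (_ : T = id); first exact: (sot_id hN).
by apply/funext => x; exact: triv.
Qed.

Section Glue.
Context (p_ : nat -> X).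
Hypothesis X0p_ : forall n, ~ X0 (p_ n).
Hypothesis coverp_ : forall q, ~ X0 q -> exists n, cls (p_ n) = cls q.

Let C n := cls (p_ n).

(* Only the first index of each class of positive measure counts. *)
Let act n := (forall k, (k < n)%N -> C k <> C n) /\ mu (C n) != 0%E.

Let mC n : measurable (C n).
Proof. by have [_ _ _ mE] := dX0; apply: mE; exact: X0p_. Qed.

Let act_unique n m q : act n -> act m -> C n q -> C m q -> n = m.
Proof.
move=> [fn _] [fm _] /cls_eq qn /cls_eq qm.
have nm : C n = C m by rewrite /C -qn -qm.
have [/fm|/fn|//] := ltngtP n m; first by rewrite nm.
by rewrite nm.
Qed.

Let ae_act : {ae mu, forall q, exists n, act n /\ C n q}.
Proof.
have h0 : {ae mu, forall q, forall n, mu (C n) = 0%E -> ~ C n q}.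
  apply: ae_foralln => n; have [m0|mn0] := pselect (mu (C n) = 0%E); last first.
    by apply: aeW => q.
  have : mu.-negligible (C n) by apply/negligibleP.
  apply: negligibleS => q /= /not_implyP[_]; exact: contrapT.
apply: filterS2 ae_X0 h0 => q X0q hq.
(* The least index whose class contains [q] is the active one, once the classes of measure zero are
   discarded. *)
have exn : exists n, `[< C n q >].
  by have [n nE] := coverp_ X0q; exists n; apply/asboolP; rewrite /C nE; exact: cls_self.
case: (ex_minnP exn) => n /asboolP Cnq nmin; exists n; split=> //; split.
  move=> k kn kE; have := nmin k; rewrite kE => h.
  by have := h (introT (asboolP _) Cnq); rewrite leqNgt kn.
by apply/eqP => /hq; apply.
Qed.

(** Inactive indices receive the zero map, so that one choice covers all [n]. Quantifying over every
    [PE] that implements the indicator avoids carrying a particular projection along. *)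
Let exG n : exists G : (H -> H) -> forall q, K q -> K q,
  [/\ (forall T, bounded_op T -> good_field mu W N (G T)),
      (forall T q v, ~ (act n /\ C n q) -> G T q v = 0),
      (forall T (D : R), 0 <= D -> (forall x, hnorm (T x) <= D * hnorm x) ->
         forall q v, hnorm (G T q v) <= D * hnorm v),
      (forall c S T q v, G ((c \*: S) \+ T) q v = c *: G S q v + G T q v) &
   act n ->
   [/\ (forall q v, C n q -> G id q v = v),
       (forall a q v, C n q -> G (pi a) q v = pi_ q a v),
       (forall m (T : 'I_m -> 'I_m -> H -> H), positive_opmx T ->
          forall q (w : 'I_m -> K q),
            0 <= \sum_(i < m) \sum_(j < m) inner (G (T i j) q (w j)) (w i)),
       (forall P T, (forall x y, rip (P x) y = rip x (P y)) ->
          (forall PE x, implements mu W (chi (C n)) PE -> PE x = x -> P x = x) ->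
          G (P \o T) = G T) &
       (forall P T q v, (forall x y, rip (P x) y = rip x (P y)) ->
          (forall PE x, implements mu W (chi (C n)) PE -> PE x = x -> P x = 0) ->
          G (P \o T) q v = 0)]].
Proof.
have [an|nan] := pselect (act n); last first.
  exists (fun T q v => 0); split=> [T _|//|T D D0 _ q v|c S T q v|//].
  - exact: zero_good.
  - by rewrite hnorm0 mulr_ge0 ?hnorm_ge0.
  - by rewrite scaler0 addr0.
have [PE bPE iPE] := indic_operator_exists (mC n).
have N_PE : N PE.
  apply: projN; exists X0, (p_ n); split=> //; first by case: an.
  by apply/diagonal_indicP.
have [_ irr _ _] := dX0.
have [|G [G1 G2 G3 G4 [G5 G6 G7 G8 G9]]] := class_expectation hW repr_pi_ hN N_pi pi_W
  (mC n) N_PE iPE (irr _ (X0p_ (n := n))) _ (proj2 an).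
  by move=> q [].
exists G; split=> //.
  by move=> T q v h; apply: G2; apply/negP; rewrite inE => Cq; apply: h.
move=> _; split=> //.
- by move=> q v Cq; apply: G5; rewrite inE.
- by move=> a q v Cq; apply: G6; rewrite inE.
- by move=> P T sP h; apply: G8 => // x; exact: h.
- by move=> P T q v sP h; apply: G9 => // x; exact: h.
Qed.

Lemma glued_expectation : exists Phi, decomposable_weak_expectation mu W pi pi_ Phi.
Proof.
have [G hG] := choice exG.
have exn q : exists n, (exists n, act n /\ C n q) -> act n /\ C n q.
  have [[n hn]|h] := pselect (exists n, act n /\ C n q); first by exists n.
  by exists 0%N => h'; exfalso; apply: h.
have [nq hnq] := choice exn.
pose F T : forall q, K q -> K q := fun q v => G (nq q) T q v.
have G0 n T q v : n <> nq q -> G n T q v = 0.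
  move=> nn; have [_ G2 _ _ _] := hG n; apply: G2 => -[an Cn]; apply: nn.
  have [an' Cn'] := hnq q (ex_intro _ n (conj an Cn)).
  exact: act_unique an an' Cn Cn'.
have Fgood T : bounded_op T -> good_field mu W N (F T).
  move=> bT; have /bounded_opP[lT [D D0 hD]] := bT.
  (* At each fiber only the index [nq q] can contribute, so these partial sums are eventually
     constant and keep the bound [D] of [T], as [good_lim] requires. *)
  pose Fm m : forall q, K q -> K q := fun q v => \sum_(n < m) G n T q v.
  have FmE m q v : Fm m q v = if (nq q < m)%N then F T q v else 0.
    rewrite /Fm; case: ifP => [lt|/negbT ge].
      rewrite (bigD1 (Ordinal lt)) //= big1 ?addr0 // => i /eqP ni; apply: G0 => e.
      by apply: ni; apply: val_inj.
    by rewrite big1 // => i _; apply: G0 => e; move: ge; rewrite -e ltn_ord.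
  have Fb q v : hnorm (F T q v) <= D * hnorm v.
    by have [_ _ G3 _ _] := hG (nq q); exact: G3.
  apply: (good_lim hW hN (Fn := Fm) D0).
  - elim=> [|m IH].
      rewrite (_ : Fm 0%N = fun q v => 0) //.
      apply: functional_extensionality_dep => q; apply/funext => v.
      by rewrite /Fm big_ord0.
    have [G1 _ _ _ _] := hG m; have := good_lcomb hW hN 1 IH (G1 T bT); congr good_field.
    apply: functional_extensionality_dep => q; apply/funext => v.
    by rewrite /Fm /= big_ord_recr /= scale1r.
  - move=> q; have [G1 _ _ _ _] := hG (nq q); have [l _ _ _] := G1 T bT; exact: l.
  - move=> m q v; rewrite FmE; case: ifP => // _.
    by rewrite hnorm0 mulr_ge0 ?hnorm_ge0.
  - move=> q v; apply/hcvgP => e e0; exists (nq q).+1 => i ni.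
    by rewrite FmE ni subrr hnorm0.
have exPhi T : exists B, bounded_op T -> N B /\ implements mu W (F T) B.
  have [bT|nbT] := pselect (bounded_op T); last by exists id.
  by have [_ _ _ [B NB iB]] := Fgood T bT; exists B.
have [Phi hPhi] := choice exPhi.
have PhiE T B : bounded_op T -> implements mu W (F T) B -> Phi T = B.
  by move=> bT; apply: (implements_unique hW); have [] := hPhi T bT.
have bpi a : bounded_op (pi a) by exact: (sot_bounded hN).
exists Phi; split; last first.
  (* The projection may come from another null set [X1], so its class [E] is compared with the
     classes [C n] only off [X1]. *)
  move=> P T [X1 [p1 [[negX1 _ _ mE] X1p1 _ /diagonal_indicP[bP iP]]]] [bT _].
  set E := fiber_equiv_class pi_ X1 p1 in iP mE.
  have aeX1 : {ae mu, forall q, ~ X1 q} by apply: negligibleS negX1 => q /contrapT.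
  apply: PhiE; first exact: bounded_op_comp.
  have sP x y : rip (P x) y = rip x (P y).
    apply: (rip_ae_eq hW); apply: filterS2 (iP x) (iP y) => q -> ->.
    by rewrite /chi; case: ifP => // _; rewrite rip0l rip0r.
  have [_ iT] := hPhi T bT.
  have GP q v : ~ X1 q -> (exists n, act n /\ C n q) -> F (P \o T) q v = chi E (F T q v).
    move=> X1q /hnq; rewrite /F; set n := nq q => -[an Cn].
    have [_ _ _ _ /(_ an)[_ _ _ G8 G9]] := hG n.
    have PEx PE x : implements mu W (chi (C n)) PE -> PE x = x ->
        {ae mu, forall r, W x r = chi (C n) (W x r)}.
      by move=> iPE ex; apply: filterS (iPE x) => r; rewrite ex.
    (* Off [X1] the class [C n] lies inside [E] or misses it. Accordingly [P] fixes or kills the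
       range of the projection of [C n]. *)
    have [np1|nnp1] := pselect (unitarily_equivalent (pi_ (p_ n)) (pi_ p1)).
      have CE r : C n r -> ~ X1 r -> E r.
        by move=> [_ rn] X1r; split=> //; exact: unitarily_equivalent_trans rn np1.
      rewrite G8 //; first by rewrite /chi mem_set //; exact: CE.
      move=> PE x iPE ex; apply: (W_inj hW).
      apply: filterS3 (iP x) (PEx PE x iPE ex) aeX1 => r -> Wr X1r.
      rewrite Wr /chi; have [|_] := boolP (r \in C n); last by case: ifP.
      by rewrite inE => Cr; rewrite mem_set //; exact: CE.
    have CE r : C n r -> ~ X1 r -> ~ E r.
      move=> [_ rn] X1r [_ rp1]; apply: nnp1.
      exact: unitarily_equivalent_trans (unitarily_equivalent_sym rn) rp1.
    rewrite G9 //; first by rewrite /chi memNset //; exact: CE.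
    move=> PE x iPE ex; apply: (W_inj hW).
    have Px0 : {ae mu, forall r, W (P x) r = 0}.
      apply: filterS3 (iP x) (PEx PE x iPE ex) aeX1 => r -> Wr X1r.
      rewrite Wr /chi; have [|_] := boolP (r \in C n); last by case: ifP.
      by rewrite inE => Cr; rewrite memNset //; exact: CE.
    by apply: filterS2 Px0 (W_0 hW) => r -> ->.
  move=> x; have h3 : {ae mu, forall q, W ((P \o Phi T) x) q = chi E (F T q (W x q))}.
    by apply: filterS2 (iP (Phi T x)) (iT x) => q /= -> ->.
  by apply: filterS3 aeX1 ae_act h3 => q X1q aq ->; rewrite GP.
split.
- by move=> T [bT _]; have [] := hPhi T bT.
- split=> [c S T [bS _] [bT _]|m T decT posT x].
    apply: PhiE; first exact: bounded_op_lcomb.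
    have [_ iS] := hPhi S bS; have [_ iT] := hPhi T bT.
    move=> x; apply: filterS (implements_lcomb hW c iS iT x) => q ->.
    by have [_ _ _ G4 _] := hG (nq q); rewrite /F G4.
  have bT i j : bounded_op (T i j) by have [] := decT i j.
  (* Collecting the inner sum leaves a single index, as in [inner_sum_ge0], and reduces positivity
     to that of [G (nq q)] at almost every fiber. *)
  pose y i := \sum_(j < m) Phi (T i j) (x j).
  have inner_suml (V : hilbertType R) (f : 'I_m -> V) w :
      inner (\sum_(j < m) f j) w = \sum_(j < m) inner (f j) w.
    by rewrite (big_morph (fun v => inner v w) (fun a b => innerD a b w) (inner0l w)).
  have -> : \sum_(i < m) \sum_(j < m) inner (Phi (T i j) (x j)) (x i) =
      \sum_(i < m) inner (y i) (x i).
    by apply: eq_bigr => i _; rewrite inner_suml.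
  apply: (inner_sum_ge0 hW).
  have yW : {ae mu, forall q, forall i, W (y i) q = \sum_(j < m) F (T i j) q (W (x j) q)}.
    apply: filter_forall => i.
    have : {ae mu, forall q, forall j, W (Phi (T i j) (x j)) q = F (T i j) q (W (x j) q)}.
      by apply: filter_forall => j; have [_ iT] := hPhi _ (bT i j); exact: iT.
    apply: filterS2 (W_sum hW (index_enum _) (fun j => Phi (T i j) (x j))) => q -> h.
    by apply: eq_bigr => j _; rewrite h.
  apply: filterS2 ae_act yW => q /hnq [an Cn] hy.
  have [_ _ _ _ /(_ an)[_ _ G7 _ _]] := hG (nq q).
  have := G7 m T posT q (fun j => W (x j) q); congr (0 <= _).
  by apply: eq_bigr => i _; rewrite hy inner_suml.
- apply: PhiE; first exact: bounded_op_id.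
  move=> x; apply: filterS ae_act => q /hnq [an Cn].
  by have [_ _ _ _ /(_ an)[G5 _ _ _ _]] := hG (nq q); rewrite /F G5.
- move=> a; apply: PhiE => // x; apply: filterS2 ae_act (pi_W a x) => q /hnq [an Cn] ->.
  by have [_ _ _ _ /(_ an)[_ G6 _ _ _]] := hG (nq q); rewrite /F G6.
Qed.

End Glue.

Lemma weak_expectation_exists : exists Phi, decomposable_weak_expectation mu W pi pi_ Phi.
Proof.
have [ex|nex] := pselect (exists p, ~ X0 p); last first.
  by exists (fun T => T); exact: weak_expectation_degenerate.
by have [p_ [h1 h2]] := class_enumeration ex; exact: glued_expectation h1 h2.
Qed.

End Main.

Theorem theorem3p7 (R : realType) (A : cstarAlgType R) (H : hilbertType R)
    (pi : A -> H -> H) (L : set (H -> H))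
    (d : measure_display) (X : measurableType d)
    (mu : {finite_measure set X -> \bar R}) (K : hilbert_field R X)
    (W : H -> forall p, K p) (pi_ : forall p, A -> K p -> K p) :
  separable A -> separable H ->
  unital_representation pi ->
  maximal_abelian L (commutant (range pi)) ->
  direct_integral_decomposition mu W pi pi_ L ->
  decomposable_masa mu pi_ ->
  (exists Phi, decomposable_weak_expectation mu W pi pi_ Phi) <->
  class_projections mu W pi_ `<=` commutant (commutant (range pi)).
Proof.
move=> _ _ urep _ [_ hW repr_pi_ _ pi_W] [X0 dX0]; split=> [[Phi hPhi] P|projN].
  exact: class_projection_of_expectation hPhi.
exact: (weak_expectation_exists hW repr_pi_ pi_W urep projN dX0).
Qed.
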